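(* Let $n,m\in\mathbb N_0$ and $g=(g_1,\dots,g_m)\in\mathbb R[X]^m$ such that $M(g)$ is Archimedean and $S(g)\ne\emptyset$. Moreover, let $k\in\mathbb N$, $N\in\mathbb N$ and $\varepsilon\in\mathbb R_{>0}$. Then there exists $d\in\mathbb N_0$ such that for all $f\in\mathbb R[X]_N$ with all coefficients in $[-N,N]$, and for $$a:=\min\{f(x)\mid x\in S(g)\}$$ and all $x_1,\dots,x_k\in\mathbb R^n$ with $\{x\in S(g)\mid f(x)=a\}=\{x_1,\dots,x_k\}$, the following holds: if the balls $B_\varepsilon(x_1),\dots,B_\varepsilon(x_k)$ are pairwise disjoint and contained in $S(g)$, and if $f\ge a+\varepsilon u$ on $S(g)$ where $u:=u_{x_1}\cdots u_{x_k}\in\mathbb R[X]$, then $f-a\in M_d(g)$ and consequently $$\operatorname{Lasserre}_d(f,g)=a.$$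
   Context: $\mathbb N$ and $\mathbb N_0$ are the positive and the nonnegative integers. $\mathbb R[X]=\mathbb R[X_1,\dots,X_n]$, and $\mathbb R[X]_N$ is the space of polynomials of (total) degree at most $N$. For $g=(g_1,\dots,g_m)\in\mathbb R[X]^m$ set $g_0:=1$ and $S(g):=\{x\in\mathbb R^n\mid g_1(x)\ge0,\dots,g_m(x)\ge0\}$. For $d\in\mathbb N_0$ the $d$-truncated quadratic module is $$M_d(g):=\Big\{\sum_{i=0}^m\sum_j p_{ij}^2g_i\ \Big|\ p_{ij}\in\mathbb R[X],\ \deg(p_{ij}^2g_i)\le d\Big\}$$ (the inner sums are finite of arbitrary length; $\deg 0:=-\infty$), and $M(g):=\bigcup_{d\in\mathbb N_0}M_d(g)$ is the quadratic module generated by $g$. $M(g)$ is called Archimedean if for every $p\in\mathbb R[X]$ there is $N'\in\mathbb N$ with $N'+p\in M(g)$ and $N'-p\in M(g)$ (this implies that $S(g)$ is compact). For $f\in\mathbb R[X]_d$, $$\operatorname{Lasserre}_d(f,g):=\inf\{L(f)\mid L\colon\mathbb R[X]_d\to\mathbb R\text{ linear},\ L(M_d(g))\subseteq\mathbb R_{\ge0},\ L(1)=1\}\in\{-\infty\}\cup\mathbb R\cup\{\infty\}.$$ $B_\varepsilon(x):=\{y\in\mathbb R^n\mid\|x-y\|<\varepsilon\}$ is the open Euclidean ball. For $x\in\mathbb R^n$, $u_x:=(X_1-x_1)^2+\dots+(X_n-x_n)^2\in\mathbb R[X]$ (here $x_1,\dots,x_n$ denote the coordinates of $x$). ''$f\ge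 h$ on $S$'' means $f(x)\ge h(x)$ for all $x\in S$. *)

(* Defs.v *)
(* mpoly has to be imported before the analysis files: the opposite order
   makes their notations clash. *)
From mathcomp Require Import all_boot all_order all_algebra.
From mathcomp Require Import mpoly.
From mathcomp Require Import classical_sets reals ereal.

Set Implicit Arguments.
Unset Strict Implicit.
Unset Printing Implicit Defensive.

Import Order.TTheory GRing.Theory Num.Theory.
Local Open Scope classical_set_scope.
Local Open Scope ring_scope.

Section Definitions.
Context {R : realType} {n : nat}.

(* msize p is deg p + 1 for p != 0 and msize 0 is 0, so that 0 (of degree
   -oo) belongs to polys_le d for every d. *)
Definition polys_le (d : nat) : set {mpoly R[n]} :=
  [set p | (msize p <= d.+1)%N].

Definition is_min (A : set R) (a : R) : Prop := A a /\ lbound A a.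

Definition semialg {m : nat} (g : 'I_m -> {mpoly R[n]}) : set 'rV[R]_n :=
  [set x | forall i, 0 <= (g i).@[x 0]].

(* The family g_0, ..., g_m: index 0 is the constant 1, and index i + 1 is the
   (0-based) i-th entry of g. *)
Definition gen {m : nat} (g : 'I_m -> {mpoly R[n]}) (i : 'I_m.+1) :
    {mpoly R[n]} :=
  oapp g 1 (unlift ord0 i).

Definition trunc_qmodule {m : nat} (d : nat) (g : 'I_m -> {mpoly R[n]}) :
    set {mpoly R[n]} :=
  [set h | exists2 p : 'I_m.+1 -> seq {mpoly R[n]},
     forall i q, q \in p i -> polys_le d (q ^+ 2 * gen g i) &
     h = \sum_i \sum_(q <- p i) q ^+ 2 * gen g i].

Definition qmodule {m : nat} (g : 'I_m -> {mpoly R[n]}) : set {mpoly R[n]} :=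
  \bigcup_d trunc_qmodule d g.

Definition archimedean_qmodule {m : nat} (g : 'I_m -> {mpoly R[n]}) : Prop :=
  forall p : {mpoly R[n]}, exists2 N : nat, (0 < N)%N &
    qmodule g (N%:R + p) /\ qmodule g (N%:R - p).

(* A linear form on polys_le d is represented by a function on all polynomials
   that is linear on polys_le d; its other values are irrelevant. *)
Definition linear_upto (d : nat) (L : {mpoly R[n]} -> R) : Prop :=
  forall (c : R) (p q : {mpoly R[n]}), polys_le d p -> polys_le d q ->
    L (c *: p + q) = c * L p + L q.

(* Meaningful for f in polys_le d. *)
Definition lasserre {m : nat} (d : nat) (f : {mpoly R[n]})
    (g : 'I_m -> {mpoly R[n]}) : \bar R :=
  ereal_inf [set (L f)%:E | L in
    [set L | [/\ linear_upto d L,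
                 forall p, trunc_qmodule d g p -> 0 <= L p &
                 L 1 = 1]]].

(* The norm provided by the library on row vectors is the sup norm, hence the
   explicit Euclidean norm. *)
Definition eucl_norm (x : 'rV[R]_n) : R := Num.sqrt (\sum_i x 0 i ^+ 2).

Definition eucl_ball (x : 'rV[R]_n) (e : R) : set 'rV[R]_n :=
  [set y | eucl_norm (x - y) < e].

Definition sqdist_poly (x : 'rV[R]_n) : {mpoly R[n]} :=
  \sum_i ('X_i - (x 0 i)%:MP) ^+ 2.

End Definitions.

(* Main.v *)
Require Import Defs.
From mathcomp Require Import all_boot all_order all_algebra.
From mathcomp Require Import mpoly.
From mathcomp Require Import classical_sets reals ereal.
From mathcomp Require Import boolp topology normedtype derive.
From mathcomp Require Import ring lra.

(** Why the theorem holds.  Put F = f - a, u_i = u_(x_i) and u = u_1 ... u_k.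
Then F vanishes at the x_i and F >= eps u on S = S(g).

If a matrix polynomial H is positive definite on S, then q^T H q lies in M(g)
for every vector q of polynomials ([uniform_putinar]).  Indeed, subtracting
sum_l g_l s_l^2 times the identity for suitable squares s_l^2 makes H positive
definite on a whole box containing S ([penalty]).  The Bernstein coefficients
of high order of the new matrix are then positive definite real matrices
([ubd_bernstein]), so they are sums of squares of linear forms ([cholesky]).
The Bernstein basis polynomials are products of the factors b + X_i and
b - X_i.  These factors lie in the quadratic module of b^2 - |X|^2, which is
closed under multiplication because it has a single generator, and
b^2 - |X|^2 is in M(g) for large b since M(g) is Archimedean.

Suppose that F has a single zero x, with a ball around it inside S and
F >= c u_x there.  Then F = Y^T G Y with Y = X - x, and G(x) is positive
definite.  Away from x the form G may be indefinite, but
H = phi G + chi F I with phi = (1 - u_x / U)^J and u_x chi = 1 - phi satisfies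
Y^T H Y = F as well: near x it is dominated by G, elsewhere by F, so it is
positive definite on S ([uniform_one_zero]).

For several zeros take Lagrange polynomials p_i with p_i(x_j) = 0 for j <> i
and p_i(x_i) = 1, and put z = 1 - sum_i p_i^2, which vanishes at all the x_i.
Subtracting from F a small multiple of sum_i p_i^2 u_i + z^(2k) leaves an F'
that is still nonnegative on S, because that sum is at most a constant times u
on the box.  Since 1 - z and z^(2k) are coprime univariate polynomials in z,
one has (1 - z) e1 + z^(2k) e0 = 1, and e1, e0 can be chosen nonnegative for
the values of z on the box ([bezout_weight_ge0]).  Hence
  F = sum_i p_i^2 (c u_i + F' e1) + z^(2k) (c + F' e0),
where each c u_i + F' e1 has the single distinguished zero x_i and the last
factor is bounded below by c on S ([uniform_many_zeros]).

All constants occurring in this argument depend on f and the x_i only through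
bounds on coefficients, on degrees and on the distances between the zeros.
To make this visible, every polynomial is treated as a family indexed by the
admissible data (f, a, x), and each step preserves families whose degrees and
coefficients are uniformly bounded.  This is what produces a single d. *)

Set Implicit Arguments.
Unset Strict Implicit.
Unset Printing Implicit Defensive.

Import Order.TTheory GRing.Theory Num.Theory.
Import numFieldNormedType.Exports.
Local Open Scope classical_set_scope.
Local Open Scope ring_scope.

(** * Bounded families of polynomials *)

Section Bounded.
Context {R : realType} {n : nat}.

(** Uniformity in the parameter t of A is expressed by working with families:
all bounds derived below depend on a family only through D and C. *)
Definition ubd (T : Type) (A : set T) (P : T -> {mpoly R[n]}) : Prop :=
  exists D C, forall t, A t ->
    (msize (P t) <= D)%N /\ forall mon, `|(P t)@_mon| <= C.

Definition sbd (T : Type) (A : set T) (c : T -> R) : Prop :=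
  exists C, forall t, A t -> `|c t| <= C.

Definition box (b : R) : set 'rV[R]_n := [set y | forall a, `|y 0 a| <= b].

Section Closure.
Context {T : Type} {A : set T}.
Implicit Types (P Q : T -> {mpoly R[n]}) (c : T -> R).

Lemma ubd_eq P Q : (forall t, A t -> P t = Q t) -> ubd A P -> ubd A Q.
Proof. by move=> PQ [D [C PC]]; exists D, C => t At; rewrite -PQ//; exact: PC. Qed.

Lemma ubdC c : sbd A c -> ubd A (fun t => (c t)%:MP).
Proof.
move=> [C cC]; exists 1%N, C => t At; split; first by rewrite msizeC; case: (_ != _).
move=> mon; rewrite mcoeffC; apply: le_trans (cC t At).
by case: eqP => _; rewrite ?mulr1// mulr0 normr0.
Qed.

Lemma ubdK p : ubd A (fun=> p).
Proof.
exists (msize p), (\sum_(mon <- msupp p) `|p@_mon|) => t _; split=> // mon.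
have [mp|] := boolP (mon \in msupp p).
  by rewrite (big_rem _ mp)/= lerDl sumr_ge0.
by rewrite -mcoeff_eq0 => /eqP ->; rewrite normr0 sumr_ge0.
Qed.

Lemma ubdD P Q : ubd A P -> ubd A Q -> ubd A (fun t => P t + Q t).
Proof.
move=> [D [C PC]] [D' [C' QC]]; exists (maxn D D'), (C + C') => t At.
have [PD Pc] := PC t At; have [QD Qc] := QC t At; split.
  apply: leq_trans (msizeD_le _ _) _.
  by rewrite geq_max !leq_max PD QD orbT.
by move=> mon; rewrite mcoeffD (le_trans (ler_normD _ _))// lerD.
Qed.

Lemma ubdM P Q : ubd A P -> ubd A Q -> ubd A (fun t => P t * Q t).
Proof.
move=> [D [C PC]] [D' [C' QC]].
pose k := (D + D').+2.
(* Each coefficient of a product is a sum over a subset of the fixed finite set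
   of pairs of monomials of degree less than k. *)
exists (D + D').+1, (\sum_(i : 'X_{1..n < k, k}) (`|C| * `|C'|)) => t At.
have [PD Pc] := PC t At; have [QD Qc] := QC t At.
have sPQ : (msize (P t * Q t)%R <= (D + D').+1)%N.
  apply: leq_trans (msizeM_le _ _) _.
  by rewrite ltnS leq_add.
split=> // mon; have [lt|ge] := ltnP (mdeg mon) k; last first.
  rewrite memN_msupp_eq0; first by rewrite normr0 sumr_ge0.
  by apply: msize_mdeg_ge; apply: leq_trans sPQ _; exact: leq_trans ge.
rewrite (mcoeff_poly_mul _ _ lt) (le_trans (ler_norm_sum _ _ _))//.
rewrite [leRHS](bigID (fun i : 'X_{1..n < k, k} => mon == (i.1 + i.2)%MM))/=.
rewrite ler_wpDr ?sumr_ge0// ler_sum// => i _; rewrite normrM ler_pM//.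
  exact: le_trans (Pc _) (ler_norm _).
exact: le_trans (Qc _) (ler_norm _).
Qed.

Lemma ubdZ c P : sbd A c -> ubd A P -> ubd A (fun t => c t *: P t).
Proof.
move=> /ubdC cC PC; apply: ubd_eq (ubdM cC PC) => t _.
by rewrite mul_mpolyC.
Qed.

Lemma ubdN P : ubd A P -> ubd A (fun t => - P t).
Proof.
move=> PC; apply: ubd_eq (ubdM (ubdK (- 1)) PC) => t _.
by rewrite mulN1r.
Qed.

Lemma ubdB P Q : ubd A P -> ubd A Q -> ubd A (fun t => P t - Q t).
Proof. by move=> PC /ubdN; exact: ubdD. Qed.

Lemma ubd_sum (I : Type) (r : seq I) (p : pred I) (F : I -> T -> {mpoly R[n]}) :
  (forall i, ubd A (F i)) -> ubd A (fun t => \sum_(i <- r | p i) F i t).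
Proof.
move=> FC; elim: r => [|i r IH].
  by apply: ubd_eq (ubdK 0) => t _; rewrite big_nil.
case pi : (p i).
  by apply: ubd_eq (ubdD (FC i) IH) => t _; rewrite big_cons pi.
by apply: ubd_eq IH => t _; rewrite big_cons pi.
Qed.

Lemma ubd_prod (I : Type) (r : seq I) (p : pred I) (F : I -> T -> {mpoly R[n]}) :
  (forall i, ubd A (F i)) -> ubd A (fun t => \prod_(i <- r | p i) F i t).
Proof.
move=> FC; elim: r => [|i r IH].
  by apply: ubd_eq (ubdK 1) => t _; rewrite big_nil.
case pi : (p i).
  by apply: ubd_eq (ubdM (FC i) IH) => t _; rewrite big_cons pi.
by apply: ubd_eq IH => t _; rewrite big_cons pi.
Qed.

Lemma ubdX P k : ubd A P -> ubd A (fun t => P t ^+ k).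
Proof.
move=> PC; elim: k => [|k IH]; first exact: ubdK.
by apply: ubd_eq (ubdM PC IH) => t _; rewrite exprS.
Qed.

(** Only the scalar coefficients depend on t, so properties that are stable under
bounded linear combinations need to be checked on fixed monomials only. *)
Lemma ubd_expand P : ubd A P -> exists D : nat,
  (forall mon : 'X_{1..n < D}, sbd A (fun t => (P t)@_mon)) /\
  forall t, A t -> P t = \sum_(mon : 'X_{1..n < D}) (P t)@_mon *: 'X_[mon].
Proof.
move=> [D [C PC]]; exists D; split=> [mon|t At].
  by exists C => t /PC[].
by rewrite -mpolywE//; case: (PC t At).
Qed.

End Closure.

Lemma sbdM T (A : set T) (c e : T -> R) : sbd A c -> sbd A e ->
  sbd A (fun t => c t * e t).
Proof.
move=> [C cC] [E eE]; exists (C * E) => t At.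
by rewrite normrM ler_pM ?cC ?eE.
Qed.

Lemma sbd_sum T (A : set T) (I : Type) (r : seq I) (F : I -> T -> R) :
  (forall i, sbd A (F i)) -> sbd A (fun t => \sum_(i <- r) F i t).
Proof.
move=> FC; elim: r => [|i r [C IH]].
  by exists 0 => t _; rewrite big_nil normr0.
have [E FE] := FC i; exists (E + C) => t At.
by rewrite big_cons (le_trans (ler_normD _ _))// lerD ?FE ?IH.
Qed.

Lemma sbd_const T (A : set T) (c : R) : sbd A (fun=> c).
Proof. by exists `|c|. Qed.

Lemma sbd_prod T (A : set T) (I : Type) (r : seq I) (F : I -> T -> R) :
  (forall i, sbd A (F i)) -> sbd A (fun t => \prod_(i <- r) F i t).
Proof.
move=> FC; elim: r => [|i r [C IH]].
  by exists 1 => t _; rewrite big_nil normr1.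
have [E FE] := FC i; exists (E * C) => t At.
by rewrite big_cons normrM ler_pM ?FE ?IH.
Qed.

Lemma sbdX T (A : set T) (c : T -> R) k : sbd A c -> sbd A (fun t => c t ^+ k).
Proof.
move=> cC; elim: k => [|k IH]; first exact: sbd_const.
have [C H] := sbdM cC IH; exists C => t /H; by rewrite exprS.
Qed.

Lemma ubd_meval T (A : set T) b (P : T -> {mpoly R[n]}) (x : T -> 'rV[R]_n) :
  (forall t, A t -> box b (x t)) -> ubd A P -> sbd A (fun t => (P t).@[x t 0]).
Proof.
move=> xb /ubd_expand[D [cD PE]].
suff [C H] : sbd A (fun t => \sum_(mon : 'X_{1..n < D})
    (P t)@_mon * \prod_(i < n) x t 0 i ^+ (mon i)).
  exists C => t At; rewrite {1}(PE t At) raddf_sum/=.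
  under eq_bigr => mon _ do rewrite mevalZ mevalX.
  exact: H.
apply: sbd_sum => mon; apply: sbdM => //.
by apply: sbd_prod => i; apply: sbdX; exists b => t /xb.
Qed.

(** The point y is made part of the parameter, so that [ubd_meval] gives a bound
that does not depend on it. *)
Lemma ubd_box T (A : set T) b (P : T -> {mpoly R[n]}) : ubd A P ->
  exists2 C, 1 <= C & forall t y, A t -> box b y -> `|(P t).@[y 0]| <= C.
Proof.
move=> [D [C PC]].
have [||E HE] := @ubd_meval _ [set ty : T * 'rV[R]_n | A ty.1 /\ box b ty.2] b
    (fun ty => P ty.1) snd.
- by move=> t [].
- by exists D, C => t [/PC].
exists (Num.max 1 E) => [|t y At yb]; first by rewrite le_max lexx.
by rewrite le_max (HE (t, y))// orbT.
Qed.

End Bounded.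

(** * Division by the linear forms X_a - x_a *)

Section Hadamard.
Context {R : realType} {n : nat} {T : Type} {A : set T} {b : R}.
Context {x : T -> 'rV[R]_n} (xb : forall t, A t -> box b (x t)).

(** Hadamard's lemma with control of the quotients: the r a form bounded families
again.  The property holds for constants and variables and is stable under
sums and products, hence it holds for every bounded family. *)
Definition divisible_at (P : T -> {mpoly R[n]}) : Prop :=
  ubd A P /\ exists2 r : 'I_n -> T -> {mpoly R[n]}, forall a, ubd A (r a) &
    forall t, A t -> P t = ((P t).@[x t 0])%:MP +
      \sum_a r a t * ('X_a - (x t 0 a)%:MP).

Lemma divisible_eq P Q : (forall t, A t -> P t = Q t) -> divisible_at P -> divisible_at Q.
Proof.
move=> PQ [PC [r rC rE]]; split; first exact: ubd_eq PC.
by exists r => // t At; rewrite -PQ// -rE.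
Qed.

Lemma divisibleC c : sbd A c -> divisible_at (fun t => (c t)%:MP).
Proof.
move=> cC; split; first exact: ubdC.
exists (fun _ _ => 0) => [a|t _]; first exact: ubdK.
by rewrite mevalC big1 ?addr0// => a _; rewrite mul0r.
Qed.

Lemma divisibleXU i : divisible_at (fun=> 'X_i).
Proof.
split; first exact: ubdK.
exists (fun a _ => (a == i)%:R) => [a|t _]; first exact: ubdK.
rewrite (bigD1 i)//= eqxx mul1r big1 ?addr0 => [|a /negPf->]; last by rewrite mul0r.
by rewrite mevalXU addrC subrK.
Qed.

Lemma divisibleD P Q : divisible_at P -> divisible_at Q ->
  divisible_at (fun t => P t + Q t).
Proof.
move=> [PC [r rC rE]] [QC [s sC sE]]; split; first exact: ubdD.
exists (fun a t => r a t + s a t) => [a|t At]; first exact: ubdD.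
rewrite {1}rE// {1}sE// mevalD mpolyCD; under [in RHS]eq_bigr do rewrite mulrDl.
by rewrite big_split/= addrACA.
Qed.

Lemma divisibleM P Q : divisible_at P -> divisible_at Q ->
  divisible_at (fun t => P t * Q t).
Proof.
move=> [PC [r rC rE]] [QC [s sC sE]]; split; first exact: ubdM.
exists (fun a t => r a t * Q t + ((P t).@[x t 0])%:MP * s a t) => [a|t At].
  by apply: ubdD; apply: ubdM => //; apply/ubdC/(ubd_meval xb).
rewrite {1}rE// mulrDl [X in (_)%:MP * X]sE// mulrDr -mpolyCM -mevalM -addrA.
congr (_ + _); under [in RHS]eq_bigr do rewrite mulrDl.
rewrite big_split/= addrC mulr_suml mulr_sumr; congr (_ + _).
  by apply: eq_bigr => a _; rewrite mulrAC.
by apply: eq_bigr => a _; rewrite mulrA.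
Qed.

Lemma divisible_sum (I : Type) (s : seq I) (F : I -> T -> {mpoly R[n]}) :
  (forall i, divisible_at (F i)) -> divisible_at (fun t => \sum_(i <- s) F i t).
Proof.
move=> FC; elim: s => [|i s IH].
  by apply: divisible_eq (divisibleC (sbd_const _ 0)) => t _; rewrite big_nil.
by apply: divisible_eq (divisibleD (FC i) IH) => t _; rewrite big_cons.
Qed.

Lemma divisible_prod (I : Type) (s : seq I) (F : I -> T -> {mpoly R[n]}) :
  (forall i, divisible_at (F i)) -> divisible_at (fun t => \prod_(i <- s) F i t).
Proof.
move=> FC; elim: s => [|i s IH].
  by apply: divisible_eq (divisibleC (sbd_const _ 1)) => t _; rewrite big_nil.
by apply: divisible_eq (divisibleM (FC i) IH) => t _; rewrite big_cons.
Qed.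

Lemma ubd_divisible P : ubd A P -> divisible_at P.
Proof.
move=> /ubd_expand[D [cD PE]].
apply: (@divisible_eq (fun t => \sum_(mon : 'X_{1..n < D})
    ((P t)@_mon)%:MP * \prod_(i < n) \prod_(j <- iota 0 (mon i)) 'X_i)).
  move=> t At; rewrite [RHS]PE//; apply: eq_bigr => mon _.
  rewrite mul_mpolyC [in RHS]mpolyXE_id; congr (_ *: _); apply: eq_bigr => i _.
  by rewrite big_const_seq count_predT size_iota -Monoid.iteropE.
apply: divisible_sum => mon; apply: divisibleM; first exact: divisibleC.
by apply: divisible_prod => i; apply: divisible_prod => j; exact: divisibleXU.
Qed.

End Hadamard.

(** Division at y', with y' as a part of the parameter, expresses the difference
of the two values through quotients that are bounded on the box. *)
Lemma ubd_lipschitz {R : realType} {n : nat} T (A : set T) b (P : T -> {mpoly R[n]}) :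
  ubd A P -> exists2 C, 1 <= C & forall t y y', A t -> box b y -> box b y' ->
    `|(P t).@[y 0] - (P t).@[y' 0]| <= C * \sum_a `|y 0 a - y' 0 a|.
Proof.
move=> [D [C PC]].
pose A' := [set ty : T * 'rV[R]_n | A ty.1 /\ box b ty.2].
have P'C : ubd A' (fun ty => P ty.1) by exists D, C => t [/PC].
have [|_ [r rC rE]] := @ubd_divisible R n _ A' b snd _ _ P'C.
  by move=> t [].
have /choice[E HE] : forall a, exists E, 1 <= E /\
    forall t y, A' t -> box b y -> `|(r a t).@[y 0]| <= E.
  by move=> a; have [E ? ?] := ubd_box b (rC a); exists E.
exists (1 + \sum_a E a) => [|t y y' At yb yb'].
  by rewrite lerDl sumr_ge0// => a _; apply: le_trans ler01 _; have [] := HE a.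
have A't : A' (t, y') by [].
rewrite {1}(rE (t, y') A't)/= mevalD mevalC addrC addKr raddf_sum/=.
rewrite (le_trans (ler_norm_sum _ _ _))// mulr_sumr ler_sum// => a _.
rewrite mevalM mevalB mevalXU mevalC normrM ler_wpM2r//.
have [E1 HEa] := HE a; apply: le_trans (HEa _ y A't yb) _.
rewrite (bigD1 a)//= addrCA lerDl addr_ge0// sumr_ge0// => c _.
by apply: le_trans ler01 _; have [] := HE c.
Qed.

(** The sum of finitely many bounds, increased by 1, serves for all of them. *)
Lemma fin_uniform_bound {R : realType} (I : finType) (Q : I -> R -> Prop) :
  (forall i C C', C <= C' -> Q i C -> Q i C') ->
  (forall i, exists2 C, 1 <= C & Q i C) -> exists2 C, 1 <= C & forall i, Q i C.
Proof.
move=> Qmono /(_ _)/cid2 HC; pose C i := s2val (HC i).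
have C0 i : 0 <= C i by apply: le_trans ler01 (s2valP (HC i)).
exists (1 + \sum_i C i) => [|i]; first by rewrite lerDl sumr_ge0.
apply: Qmono (s2valP' (HC i)); rewrite (bigD1 i)//= addrCA lerDl.
by rewrite addr_ge0// sumr_ge0.
Qed.

Lemma ubd_lipschitz_fin {R : realType} {n : nat} T (A : set T) b (I : finType)
    (P : I -> T -> {mpoly R[n]}) :
  (forall i, ubd A (P i)) -> exists2 C, 1 <= C & forall i t y y', A t ->
    box b y -> box b y' ->
    `|(P i t).@[y 0] - (P i t).@[y' 0]| <= C * \sum_a `|y 0 a - y' 0 a|.
Proof.
move=> PC; apply: fin_uniform_bound => [i C C' CC' H t y y' At yb yb'|i].
  by apply: le_trans (H t y y' At yb yb') _; rewrite ler_wpM2r ?sumr_ge0.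
exact: ubd_lipschitz.
Qed.

Lemma ubd_box_fin {R : realType} {n : nat} T (A : set T) b (I : finType)
    (P : I -> T -> {mpoly R[n]}) :
  (forall i, ubd A (P i)) -> exists2 C, 1 <= C & forall i t y, A t ->
    box b y -> `|(P i t).@[y 0]| <= C.
Proof.
move=> PC; apply: fin_uniform_bound => [i C C' CC' H t y At yb|i].
  exact: le_trans (H t y At yb) _.
exact: ubd_box.
Qed.

(** * Truncated quadratic modules *)

Section QuadraticModule.
Context {R : realType} {n m : nat} (g : 'I_m -> {mpoly R[n]}).
Implicit Types (p q h : {mpoly R[n]}).

Lemma trunc_qmodule_le d d' p : (d <= d')%N ->
  trunc_qmodule d g p -> trunc_qmodule d' g p.
Proof.
move=> dd' [f fd ->]; exists f => // i q /fd; rewrite /polys_le/= => fq.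
exact: leq_trans fq _.
Qed.

Lemma trunc_qmoduleD d p q :
  trunc_qmodule d g p -> trunc_qmodule d g q -> trunc_qmodule d g (p + q).
Proof.
move=> [f fd ->] [f' fd' ->]; exists (fun i => f i ++ f' i).
  by move=> i r; rewrite mem_cat => /orP[/fd|/fd'].
by rewrite -big_split; apply: eq_bigr => i _; rewrite big_cat.
Qed.

Lemma trunc_qmodule0 d : trunc_qmodule d g 0.
Proof. by exists (fun=> [::]) => //; rewrite big1// => i _; rewrite big_nil. Qed.

Lemma trunc_qmodule_sum d (I : Type) (s : seq I) (F : I -> {mpoly R[n]}) :
  (forall i, trunc_qmodule d g (F i)) -> trunc_qmodule d g (\sum_(i <- s) F i).
Proof.
move=> FM; elim: s => [|i s IH]; first by rewrite big_nil; exact: trunc_qmodule0.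
by rewrite big_cons; exact: trunc_qmoduleD.
Qed.

(** The increase of the degree is not sharp; it only matters that it depends on
nothing but e. *)
Lemma trunc_qmodule_sqrM d e p q : (msize q <= e)%N ->
  trunc_qmodule d g p -> trunc_qmodule (d + e.*2.+2) g (q ^+ 2 * p).
Proof.
move=> qe [f fd ->]; exists (fun i => [seq q * r | r <- f i]).
  move=> i _ /mapP[r /fd rd ->]; rewrite /polys_le/= exprMn -mulrA.
  apply: leq_trans (msizeM_le _ _) _; rewrite ltnS addnC -addSnnS.
  apply: leq_add => //; apply: leq_trans (msizeM_le _ _) _.
  by rewrite -addnn ltnS leq_add.
rewrite mulr_sumr; apply: eq_bigr => i _; rewrite big_map mulr_sumr.
by apply: eq_bigr => r _; rewrite exprMn mulrA.
Qed.

Lemma trunc_qmodule_gen i q :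
  trunc_qmodule (msize (q ^+ 2 * gen g i)) g (q ^+ 2 * gen g i).
Proof.
exists (fun j => if j == i then [:: q] else [::]).
  move=> j r; case: eqP => [->|//]; rewrite inE => /eqP ->.
  exact: leqnSn.
rewrite (bigD1 i)//= eqxx big_seq1 big1 ?addr0// => j /negPf->.
by rewrite big_nil.
Qed.

Lemma gen0 : gen g ord0 = 1. Proof. by rewrite /gen unlift_none. Qed.

Lemma gen_lift i : gen g (lift ord0 i) = g i.
Proof. by rewrite /gen liftK. Qed.

Lemma qmodule_semialg p y : qmodule g p -> semialg g y -> 0 <= p.@[y 0].
Proof.
move=> [d _ [f _ ->]] gy; rewrite raddf_sum sumr_ge0// => i _.
rewrite raddf_sum sumr_ge0//= => q _; rewrite mevalM rmorphXn/= mulr_ge0 ?sqr_ge0//.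
rewrite /gen; case: unliftP => [j|] _ /=; first exact: gy.
by rewrite meval1.
Qed.

Lemma qmoduleD p q : qmodule g p -> qmodule g q -> qmodule g (p + q).
Proof.
move=> [d _ pd] [e _ qe]; exists (maxn d e) => //; apply: trunc_qmoduleD.
  by apply: trunc_qmodule_le pd; exact: leq_maxl.
by apply: trunc_qmodule_le qe; exact: leq_maxr.
Qed.

Lemma qmodule_sqrM p q : qmodule g p -> qmodule g (q ^+ 2 * p).
Proof. by move=> [d _ pd]; eexists => //; exact: trunc_qmodule_sqrM pd. Qed.

Lemma qmodule1 : qmodule g 1.
Proof.
exists 1%N => //; have := trunc_qmodule_gen ord0 1.
by rewrite gen0 expr1n mulr1 msize1.
Qed.

Definition sos p : Prop := exists s : seq {mpoly R[n]}, p = \sum_(q <- s) q ^+ 2.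

Lemma sosD p q : sos p -> sos q -> sos (p + q).
Proof. by move=> [s ->] [t ->]; exists (s ++ t); rewrite big_cat. Qed.

Lemma sos_sqr q : sos (q ^+ 2).
Proof. by exists [:: q]; rewrite big_seq1. Qed.

Lemma sos0 : sos 0. Proof. by exists [::]; rewrite big_nil. Qed.

Lemma sosM p q : sos p -> sos q -> sos (p * q).
Proof.
move=> [s ->] [t ->]; exists [seq u * v | u <- s, v <- t].
rewrite big_allpairs_dep mulr_suml; apply: eq_bigr => u _.
by rewrite mulr_sumr; apply: eq_bigr => v _; rewrite exprMn.
Qed.

Lemma sosC c : 0 <= c -> sos c%:MP.
Proof. by move=> c0; rewrite -(sqr_sqrtr c0) rmorphXn; exact: sos_sqr. Qed.

Lemma qmodule_sosM s h : sos s -> qmodule g h -> qmodule g (s * h).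
Proof.
move=> [t ->] hM; elim: t => [|q t IH].
  by rewrite big_nil mul0r; exists 0%N => //; exact: trunc_qmodule0.
by rewrite big_cons mulrDl; apply: qmoduleD IH; exact: qmodule_sqrM.
Qed.

(** The quadratic module generated by h alone.  It is closed under
multiplication because the product h * h of its generator is a square. *)
Definition preordering1 h p : Prop := exists s t, [/\ sos s, sos t & p = s + t * h].

Lemma preordering1_qmodule h p : qmodule g h -> preordering1 h p -> qmodule g p.
Proof.
move=> hM [s [t [ss st ->]]]; apply: qmoduleD; last exact: qmodule_sosM.
by rewrite -[s]mulr1; exact: qmodule_sosM ss qmodule1.
Qed.

Lemma preordering1_sos h p : sos p -> preordering1 h p.
Proof. by move=> sp; exists p, 0; split; [|exact: sos0|rewrite mul0r addr0]. Qed.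

Lemma preordering1M h p q : preordering1 h p -> preordering1 h q ->
  preordering1 h (p * q).
Proof.
move=> [s [t [ss st ->]]] [s' [t' [ss' st' ->]]].
exists (s * s' + h ^+ 2 * (t * t')), (s * t' + t * s'); split; last by ring.
  by apply: sosD; [exact: sosM|apply: sosM; [exact: sos_sqr|exact: sosM]].
by apply: sosD; exact: sosM.
Qed.

Lemma preordering1_prod h (I : Type) (s : seq I) (F : I -> {mpoly R[n]}) :
  (forall i, preordering1 h (F i)) -> preordering1 h (\prod_(i <- s) F i).
Proof.
move=> Fh; elim: s => [|i s IH].
  by rewrite big_nil; apply: preordering1_sos; rewrite -(expr1n _ 2); exact: sos_sqr.
by rewrite big_cons; exact: preordering1M.
Qed.

Lemma preordering1X h p k : preordering1 h p -> preordering1 h (p ^+ k).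
Proof.
move=> hp; have := preordering1_prod (iota 0 k) (fun=> hp).
by rewrite big_const_seq count_predT size_iota -Monoid.iteropE.
Qed.

(** Nonnegativity of this polynomial defines the ball inscribed in [box b]. *)
Definition box_ball (b : R) : {mpoly R[n]} := (b ^+ 2)%:MP - \sum_a 'X_a ^+ 2.

(** 2 b (b + e) = (b + e)^2 + (b^2 - e^2) for e = 'X_a or e = - 'X_a, and b^2 - e^2
is [box_ball b] plus the squares of the other variables. *)
Lemma preordering1_face b a : 0 < b ->
  preordering1 (box_ball b) (b%:MP + 'X_a) /\
  preordering1 (box_ball b) (b%:MP - 'X_a).
Proof.
move=> b0; set h := box_ball b.
pose c : {mpoly R[n]} := ((2 * b)^-1)%:MP.
have sc : sos c by apply: sosC; rewrite invr_ge0 mulr_ge0// ltW.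
have cb : 2 * b%:MP * c = 1.
  rewrite -[2]/(2%:R) -mpolyC_nat -!mpolyCM divff// mulf_neq0 ?pnatr_eq0//.
  exact: lt0r_neq0.
pose o : {mpoly R[n]} := \sum_(a' | a' != a) 'X_a' ^+ 2.
have so : sos o.
  by rewrite /o -big_filter; elim: [seq _ <- _ | _] => [|i s IH];
     rewrite ?big_nil ?big_cons; [exact: sos0|apply: sosD IH; exact: sos_sqr].
have hE : b%:MP ^+ 2 - 'X_a ^+ 2 = h + o.
  by rewrite /h /box_ball (bigD1 a)//= -/o rmorphXn; ring.
have key e : e ^+ 2 = 'X_a ^+ 2 -> preordering1 h (b%:MP + e).
  move=> eE; exists (c * ((b%:MP + e) ^+ 2 + o)), c; split=> //.
    by apply: sosM => //; apply: sosD => //; exact: sos_sqr.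
  have -> : o = b%:MP ^+ 2 - e ^+ 2 - h by rewrite eE hE; ring.
  by rewrite -[LHS]mul1r -cb; ring.
by split; apply: key; rewrite ?sqrrN.
Qed.

End QuadraticModule.

(** * Bernstein expansion on a box *)

Section Bernstein.
Context {R : realType} {n : nat} (b : R) (b_gt0 : 0 < b).

(** Since k ^_ e * 'C(K, k) = K ^_ e * 'C(K - e, k - e), this is the binomial
theorem for (x + y)^(K - e). *)
Lemma bernstein_expX (S : comNzRingType) (x y : S) (e K : nat) : x + y = 1 ->
  \sum_(k < K.+1) (k ^_ e * 'C(K, k))%:R * (x ^+ k * y ^+ (K - k)) =
  (K ^_ e)%:R * x ^+ e.
Proof.
move=> xy1; elim: e K => [|e IH] K.
  transitivity ((y + x) ^+ K); last by rewrite addrC xy1 expr1n ffactn0 mulr1.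
  rewrite exprDn; apply: eq_bigr => k _.
  by rewrite ffactn0 mul1n mulr_natl [x ^+ k * _]mulrC.
case: K => [|K].
  by rewrite big_ord_recl big_ord0 !ffact0n mul0n !mul0r addr0.
rewrite big_ord_recl/= !ffact0n mul0n mul0r add0r !ffactnS/= natrM -!mulrA.
rewrite exprS [x * _]mulrC [(K ^_ e)%:R * _]mulrA -IH mulr_suml mulr_sumr.
apply: eq_bigr => k _; rewrite /bump/= add1n ffactnS/= subSS.
have -> : (k.+1 * k ^_ e * 'C(K.+1, k.+1) = K.+1 * (k ^_ e * 'C(K, k)))%N.
  by rewrite -mulnA mulnCA -mul_bin_diag mulnCA.
by rewrite natrM exprS; ring.
Qed.

(** The k-th Bernstein coefficient of order K of the monomial s^e on [0, 1]. *)
Definition ffact_ratio (K e k : nat) : R := (k ^_ e)%:R / (K ^_ e)%:R.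

Lemma ffact_ratio01 K e k : (k <= K)%N -> 0 <= ffact_ratio K e k <= 1.
Proof.
move=> kK; rewrite divr_ge0//=.
have [eK|eK] := leqP e K; last first.
  by rewrite /ffact_ratio [(K ^_ e)%N]ffact_small// invr0 mulr0.
rewrite ler_pdivrMr ?mul1r ?ltr0n ?ffact_gt0// ler_nat.
elim: e {eK} => [//|e IH]; rewrite !ffactnSr leq_mul// leq_sub2r//.
Qed.

Lemma ler_dist_mul01 (u v u' v' : R) : 0 <= u <= 1 -> 0 <= v' <= 1 ->
  `|u * v - u' * v'| <= `|u - u'| + `|v - v'|.
Proof.
move=> /andP[u0 u1] /andP[v0 v1].
have -> : u * v - u' * v' = (u - u') * v' + u * (v - v') by ring.
apply: le_trans (ler_normD _ _) _; rewrite !normrM lerD//.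
  by rewrite ler_piMr// ger0_norm.
by rewrite ler_piMl// ger0_norm.
Qed.

(** The ratio is the product over j < e of (k - j) / (K - j), and each factor is
at distance at most j / K from k / K. *)
Lemma ffact_ratio_approx K e k : (k <= K)%N -> (e <= K)%N -> (0 < K)%N ->
  `|ffact_ratio K e k - (k%:R / K%:R) ^+ e| <= (e ^ 2)%:R / K%:R.
Proof.
move=> kK eK K0; have K0' : 0 < K%:R :> R by rewrite ltr0n.
elim: e eK => [|e IH] eK.
  by rewrite /ffact_ratio !ffactn0 expr0 divr1 subrr normr0 divr_ge0.
have {}IH := IH (ltnW eK).
have -> : ffact_ratio K e.+1 k =
    ffact_ratio K e k * ((k - e)%:R / (K - e)%:R).
  by rewrite /ffact_ratio !ffactnSr !natrM invfM; ring.
rewrite exprSr; apply: le_trans (ler_dist_mul01 _ _ _ _) _.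
- exact: ffact_ratio01.
- by rewrite divr_ge0//= ler_pdivrMr// mul1r ler_nat.
have Ke0 : 0 < (K - e)%:R :> R by rewrite ltr0n subn_gt0.
have : `|(k - e)%:R / (K - e)%:R - k%:R / K%:R| <= e%:R / K%:R :> R.
  have [ke|ke] := ltnP k e.
    have -> : (k - e = 0)%N by apply/eqP; rewrite subn_eq0 ltnW.
    rewrite mul0r sub0r normrN ger0_norm ?divr_ge0//.
    by rewrite ler_wpM2r ?invr_ge0// ler_nat ltnW.
  rewrite (natrB _ ke) (natrB _ (ltnW eK)) in Ke0 *.
  have -> : (k%:R - e%:R) / (K%:R - e%:R) - k%:R / K%:R =
     - (e%:R / K%:R * ((K%:R - k%:R) / (K%:R - e%:R))) :> R.
    by field; rewrite !lt0r_neq0.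
  have kK' : k%:R <= K%:R :> R by rewrite ler_nat.
  have ke' : e%:R <= k%:R :> R by rewrite ler_nat.
  rewrite normrN ger0_norm; last first.
    by rewrite mulr_ge0 ?divr_ge0 ?subr_ge0// ltW// -subr_gt0.
  rewrite ler_piMr ?divr_ge0// ler_pdivrMr// mul1r lerD2l lerN2//.
move=> H; apply: le_trans (lerD IH H) _.
rewrite -mulrDl ler_wpM2r ?invr_ge0// -natrD ler_nat.
by rewrite -[e.+1]addn1 sqrnD -addnA leq_add2l muln1 mul2n -addnn addnA leq_addl.
Qed.

Lemma ler_dist_prod01 (I : Type) (s : seq I) (u v : I -> R) :
  (forall i, 0 <= u i <= 1) -> (forall i, 0 <= v i <= 1) ->
  `|\prod_(i <- s) u i - \prod_(i <- s) v i| <= \sum_(i <- s) `|u i - v i|.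
Proof.
move=> u01 v01; elim: s => [|i s IH]; first by rewrite !big_nil subrr normr0.
rewrite !big_cons; apply: le_trans (ler_dist_mul01 _ _ _ _) _ => //.
  elim: s {IH} => [|j s /andP[IH0 IH1]]; first by rewrite big_nil ler01 lexx.
  have /andP[v0 v1] := v01 j.
  by rewrite big_cons mulr_ge0//= mulr_ile1.
by rewrite lerD2l.
Qed.

(** [lo i] and [hi i] are the barycentric coordinates of [- b, b] in direction i. *)
Definition lo (i : 'I_n) : {mpoly R[n]} := ((2 * b)^-1)%:MP * (b%:MP + 'X_i).
Definition hi (i : 'I_n) : {mpoly R[n]} := ((2 * b)^-1)%:MP * (b%:MP - 'X_i).

Lemma lohi i : lo i + hi i = 1.
Proof.
rewrite /lo /hi -mulrDr addrCA addrK -mpolyCD -mpolyCM -mpolyC1.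
by congr (_%:MP); field; rewrite lt0r_neq0.
Qed.

Definition bernstein K (al : {ffun 'I_n -> 'I_K.+1}) : {mpoly R[n]} :=
  \prod_i (('C(K, al i)%:R) * (lo i ^+ al i * hi i ^+ (K - al i))).

Definition grid K (al : {ffun 'I_n -> 'I_K.+1}) : 'rV[R]_n :=
  \row_i (b * (2 * ((al i)%:R / K%:R) - 1)).

Lemma grid_box K al : (0 < K)%N -> box b (@grid K al).
Proof.
move=> K0 a; rewrite mxE normrM gtr0_norm//.
apply: ler_piMr; first exact: ltW.
rewrite ler_norml.
set w : R := _ / _.
suff /andP[w0 w1] : 0 <= w <= 1 by apply/andP; split; lra.
by rewrite divr_ge0//= ler_pdivrMr ?ltr0n// mul1r ler_nat -ltnS.
Qed.

Lemma lo_grid K al i : (lo i).@[@grid K al 0] = (al i)%:R / K%:R.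
Proof.
rewrite mevalM mevalD !mevalC mevalXU mxE.
by set w : R := _ / K%:R; field; rewrite lt0r_neq0.
Qed.

(** The Bernstein coefficients of high order are close to the values at the grid
points, so they inherit strict positivity from the polynomial. *)
Definition bapprox (p : {mpoly R[n]}) : Prop :=
  forall e, 0 < e -> exists K0, forall K, (K0 <= K)%N ->
    exists2 c, p = \sum_al c al *: bernstein al &
    forall al : {ffun 'I_n -> 'I_K.+1}, `|c al - p.@[grid al 0]| <= e.

Lemma bapproxD p q : bapprox p -> bapprox q -> bapprox (p + q).
Proof.
move=> pa qa e e0; have e20 : 0 < e / 2 by rewrite divr_gt0.
have [K1 H1] := pa _ e20; have [K2 H2] := qa _ e20.
exists (maxn K1 K2) => K; rewrite geq_max => /andP[/H1[c pE cE] /H2[c' qE cE']].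
exists (fun al => c al + c' al).
  rewrite {1}pE {1}qE -big_split; apply: eq_bigr => al _.
  by rewrite scalerDl.
move=> al; rewrite mevalD opprD addrACA (le_trans (ler_normD _ _))//.
by rewrite [leRHS]splitr lerD.
Qed.

Lemma bapproxZ a p : bapprox p -> bapprox (a *: p).
Proof.
move=> pa e e0; have a0 : 0 < `|a| + 1 by rewrite ltr_wpDl.
have [|K0 H] := pa (e / (`|a| + 1)); first by rewrite divr_gt0.
exists K0 => K /H[c pE cE]; exists (fun al => a * c al).
  by rewrite {1}pE scaler_sumr; apply: eq_bigr => al _; rewrite scalerA.
move=> al; rewrite mevalZ -mulrBr normrM.
apply: le_trans (ler_wpM2l (normr_ge0 _) (cE al)) _.
by rewrite mulrCA ler_piMr ?ltW// ltr_pdivrMr// mul1r ltrDl.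
Qed.

Lemma bapprox0 : bapprox 0.
Proof.
move=> e e0; exists 0%N => K _; exists (fun=> 0).
  by rewrite big1// => al _; rewrite scale0r.
by move=> al; rewrite meval0 subrr normr0 ltW.
Qed.

Lemma bapprox_sum (I : Type) (s : seq I) (F : I -> {mpoly R[n]}) :
  (forall i, bapprox (F i)) -> bapprox (\sum_(i <- s) F i).
Proof.
move=> Fa; elim: s => [|i s IH]; first by rewrite big_nil; exact: bapprox0.
by rewrite big_cons; exact: bapproxD.
Qed.

Lemma bapprox_monomial (mon : 'X_{1..n}) : bapprox (\prod_i lo i ^+ mon i).
Proof.
move=> e e0; set D := mdeg mon.
have monD i : (mon i <= D)%N by rewrite /D mdegE (bigD1 i)//= leq_addr.
pose W : R := n%:R * (D ^ 2)%:R.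
have [K1 HK1] : exists K1 : nat, W / e < K1%:R.
  by exists (Num.truncn (W / e)).+1; exact: truncnS_gt.
exists (maxn K1 D.+1) => K; rewrite geq_max => /andP[K1K DK].
have K0 : (0 < K)%N by exact: leq_trans DK.
exists (fun al : {ffun 'I_n -> 'I_K.+1} => \prod_i ffact_ratio K (mon i) (al i)).
  under eq_bigr => i _.
    have Ki : (mon i <= K)%N by apply: leq_trans (monD i) _; exact: ltnW.
    have -> : lo i ^+ mon i = \sum_(k < K.+1)
       (ffact_ratio K (mon i) k)%:MP *
         ('C(K, k)%:R * (lo i ^+ k * hi i ^+ (K - k))).
      have f0 : (K ^_ (mon i))%:R != 0 :> R by rewrite pnatr_eq0 -lt0n ffact_gt0.
      transitivity (((K ^_ (mon i))%:R^-1)%:MP *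
          ((K ^_ (mon i))%:R * lo i ^+ mon i)).
        by rewrite mulrA -mpolyC_nat -mpolyCM mulVf// mul1r.
      rewrite -(bernstein_expX _ _ (lohi i)) mulr_sumr; apply: eq_bigr => k _.
      by rewrite /ffact_ratio natrM mpolyCM mpolyC_nat; ring.
    over.
  rewrite bigA_distr_bigA/=; apply: eq_bigr => al _.
  by rewrite big_split/= -mul_mpolyC rmorph_prod.
move=> al; rewrite rmorph_prod/=.
under [X in _ - X]eq_bigr do rewrite rmorphXn/= lo_grid.
have alK i : (al i <= K)%N by rewrite -ltnS.
apply: le_trans (ler_dist_prod01 _ _ _) _ => [i|i|].
- exact: ffact_ratio01.
- have w01 : 0 <= ((al i)%:R / K%:R : R) <= 1.
    by rewrite divr_ge0//= ler_pdivrMr ?ltr0n// mul1r ler_nat.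
  by have /andP[w0 w1] := w01; rewrite exprn_ge0//= exprn_ile1.
apply: (@le_trans _ _ (\sum_(i < n) (D ^ 2)%:R / K%:R)).
  apply: ler_sum => i _; apply: le_trans (ffact_ratio_approx _ _ _) _ => //.
    by apply: leq_trans (monD i) _; exact: ltnW.
  by rewrite ler_wpM2r ?invr_ge0// ler_nat leq_exp2r.
rewrite sumr_const card_ord -[leLHS]mulr_natl mulrA ler_pdivrMr ?ltr0n//.
rewrite [leRHS]mulrC -ler_pdivrMr//; apply: ltW; apply: (lt_le_trans HK1).
by rewrite ler_nat.
Qed.

(** The affine substitution that sends [- b, b] to [0, 1] writes p as a polynomial
in the coordinates [lo i], whose monomials are covered by [bapprox_monomial]. *)
Lemma bapprox_all p : bapprox p.
Proof.
pose q := p \mPo [tuple (2 * b)%:MP * 'X_i - b%:MP | i < n].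
have -> : p = q \mPo [tuple lo i | i < n].
  rewrite /q [p \mPo [tuple (2 * b)%:MP * 'X_i - b%:MP | i < n]]comp_mpolyE raddf_sum/= [LHS]mpolyE.
  apply: eq_bigr => mon _; rewrite comp_mpolyZ rmorph_prod/=.
  rewrite mpolyXE_id; congr (_ *: _); apply: eq_bigr => i _.
  rewrite rmorphXn/= tnth_mktuple; congr (_ ^+ _).
  have lX : 'X_i \mPo [tuple lo i | i < n] = lo i.
    by rewrite comp_mpolyXU -tnth_nth tnth_mktuple.
  have lb : (2 * b)%:MP * lo i - b%:MP = 'X_i.
    rewrite /lo [_ * (_ * _)]mulrA -mpolyCM.
    have -> : 2 * b * (2 * b)^-1 = 1 by field; rewrite lt0r_neq0.
    by rewrite mpolyC1 mul1r addrC addKr.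
  by rewrite rmorphB rmorphM/= !comp_mpolyC lX lb.
rewrite comp_mpolyE; apply: bapprox_sum => mon; apply: bapproxZ.
under eq_bigr do rewrite tnth_mktuple.
exact: bapprox_monomial.
Qed.

(** Finitely many fixed monomials are expanded to the accuracy e / W, where W
exceeds the sum of the bounds of the coefficients of the family. *)
Lemma ubd_bernstein T (A : set T) (P : T -> {mpoly R[n]}) e : ubd A P -> 0 < e ->
  exists K0, forall K, (K0 <= K)%N -> exists c, forall t, A t ->
    P t = \sum_al c t al *: bernstein al /\
    forall al : {ffun 'I_n -> 'I_K.+1}, `|c t al - (P t).@[grid al 0]| <= e.
Proof.
move=> /ubd_expand[D [cD PE]] e0.
have {cD}[C HC] := choice cD.
pose W := 1 + \sum_(mon : 'X_{1..n < D}) `|C mon|.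
have W0 : 0 < W by rewrite ltr_pwDl// sumr_ge0.
have /choice[K0 HK] : forall mon : 'X_{1..n < D}, exists K0, forall K, (K0 <= K)%N ->
    exists2 c, 'X_[mon] = \sum_al c al *: bernstein al &
    forall al : {ffun 'I_n -> 'I_K.+1}, `|c al - ('X_[mon]).@[grid al 0]| <= e / W.
  by move=> mon; apply: bapprox_all; rewrite divr_gt0.
exists (\max_mon K0 mon)%N => K KK.
have /choice[c Hc] : forall mon : 'X_{1..n < D}, exists c,
    'X_[mon] = \sum_al c al *: bernstein al /\
    forall al : {ffun 'I_n -> 'I_K.+1}, `|c al - ('X_[mon]).@[grid al 0]| <= e / W.
  move=> mon; have [|c ? ?] := HK mon K; last by exists c.
  by apply: leq_trans KK; exact: leq_bigmax.
exists (fun t al => \sum_(mon : 'X_{1..n < D}) (P t)@_mon * c mon al) => t At; split.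
  rewrite {1}(PE t At); under eq_bigr => mon _.
    rewrite {1}(Hc mon).1 scaler_sumr.
    under eq_bigr do rewrite scalerA.
    over.
  by rewrite exchange_big; apply: eq_bigr => al _; rewrite scaler_suml.
move=> al.
have -> : (P t).@[grid al 0] =
    \sum_(mon : 'X_{1..n < D}) (P t)@_mon * ('X_[mon]).@[grid al 0].
  rewrite {1}(PE t At) raddf_sum; apply: eq_bigr => mon _.
  exact: mevalZ.
rewrite -sumrB.
apply: le_trans (ler_norm_sum _ _ _) _.
apply: (@le_trans _ _ (\sum_(mon : 'X_{1..n < D}) `|C mon| * (e / W))).
  apply: ler_sum => mon _; rewrite -mulrBr normrM ler_pM//.
    exact: le_trans (HC mon t At) (ler_norm _).
  by have [_] := Hc mon; exact.
by rewrite -mulr_suml mulrCA ler_piMr ?ltW// ltr_pdivrMr// mul1r /W ltrDr.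
Qed.

End Bernstein.

(** * Quadratic forms *)

Section QuadraticForm.

Definition qform (S : comNzRingType) r (C : 'I_r -> 'I_r -> S) (v : 'I_r -> S) : S :=
  \sum_i \sum_j C i j * (v i * v j).

Context {R : realType}.

(** Completion of the square with respect to the first variable.  The morphism phi
allows the arguments q to be polynomials while the coefficients are real. *)
Lemma qform_split (S : comNzRingType) (phi : {rmorphism R -> S}) r
    (C : 'I_r.+1 -> 'I_r.+1 -> R) (q : 'I_r.+1 -> S) : C ord0 ord0 != 0 ->
  let s := C ord0 ord0 in
  let w i := (C ord0 (lift ord0 i) + C (lift ord0 i) ord0) / 2 in
  qform (fun i j => phi (C i j)) q =
  phi s * (q ord0 + \sum_i phi (w i / s) * q (lift ord0 i)) ^+ 2 +
  qform (fun i j => phi (C (lift ord0 i) (lift ord0 j) - w i * w j / s))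
    (fun i => q (lift ord0 i)).
Proof.
move=> s0 s w; set q' := fun i => q (lift ord0 i).
set B := \sum_i phi (w i) * q' i.
have -> : \sum_i phi (w i / s) * q (lift ord0 i) = phi s^-1 * B.
  rewrite mulr_sumr; apply: eq_bigr => i _.
  by rewrite mulrA -rmorphM mulrC -[w i / s]mulrC mulrC.
have sK : phi s * phi s^-1 = 1 by rewrite -rmorphM divff// rmorph1.
have BB : phi s^-1 * B ^+ 2 = \sum_i \sum_j phi (w i * w j / s) * (q' i * q' j).
  rewrite expr2 {1}/B mulr_suml mulr_sumr; apply: eq_bigr => i _.
  rewrite /B !mulr_sumr; apply: eq_bigr => j _.
  by rewrite !rmorphM; ring.
have -> : qform (fun i j => phi (C (lift ord0 i) (lift ord0 j) - w i * w j / s)) q' =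
    \sum_i \sum_j phi (C (lift ord0 i) (lift ord0 j)) * (q' i * q' j) - phi s^-1 * B ^+ 2.
  rewrite BB -sumrB; apply: eq_bigr => i _; rewrite -sumrB; apply: eq_bigr => j _.
  by rewrite rmorphB mulrBl.
have BE : \sum_(j < r) phi (C ord0 (lift ord0 j)) * (q ord0 * q' j) +
    \sum_(i < r) phi (C (lift ord0 i) ord0) * (q' i * q ord0) = 2 * (q ord0 * B).
  rewrite -big_split/= mulrA /B mulr_sumr; apply: eq_bigr => i _.
  have -> : phi (C ord0 (lift ord0 i)) * (q ord0 * q' i) +
    phi (C (lift ord0 i) ord0) * (q' i * q ord0) =
    phi (C ord0 (lift ord0 i) + C (lift ord0 i) ord0) * (q ord0 * q' i).
    by rewrite rmorphD; ring.
  have -> : C ord0 (lift ord0 i) + C (lift ord0 i) ord0 = w i *+ 2.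
    by rewrite -[w i *+ 2]mulr_natr /w divfK// pnatr_eq0.
  by rewrite rmorphMn/= -mulr_natl; ring.
rewrite /qform big_ord_recl big_ord_recl -/s.
under [X in _ + X = _]eq_bigr do rewrite big_ord_recl.
rewrite big_split/=.
set Z := \sum_i \sum_j _.
set X1 := \sum_(j < r) _ in BE *; set X2 := \sum_(j < r) _ in BE *.
transitivity (phi s * (q ord0 * q ord0) + (X1 + X2) + Z); first by rewrite !addrA.
rewrite BE; transitivity (phi s * q ord0 ^+ 2 + 2 * (phi s * phi s^-1) * (q ord0 * B) + Z
  + ((phi s * phi s^-1) * phi s^-1 * B ^+ 2 - phi s^-1 * B ^+ 2)).
  by rewrite sK; ring.
by ring.
Qed.

(** Positivity on real vectors yields one matrix W that decomposes the form at
arguments in any R-algebra, in particular at vectors of polynomials. *)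
Lemma cholesky r (C : 'I_r -> 'I_r -> R) (dl : R) : 0 < dl ->
  (forall v, dl * \sum_i v i ^+ 2 <= qform C v) ->
  exists W : 'I_r -> 'I_r -> R, forall (S : comNzRingType) (phi : {rmorphism R -> S}) q,
    qform (fun i j => phi (C i j)) q = \sum_k (\sum_i phi (W k i) * q i) ^+ 2.
Proof.
move=> dl0; elim: r C => [|r IH] C Cp.
  by exists (fun _ _ => 0) => S phi q; rewrite /qform !big_ord0.
set s := C ord0 ord0.
have s0 : 0 < s.
  apply: lt_le_trans dl0 _; have := Cp (fun i => (i == ord0)%:R).
  rewrite (bigD1 ord0)//= big1 => [|i /negPf->]; last by rewrite expr0n.
  have -> : qform C (fun i => (i == ord0)%:R) = s.
    rewrite /qform (bigD1 ord0)//= [X in _ + X]big1 => [|i /negPf->]; last first.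
      by rewrite big1// => j _; rewrite mul0r mulr0.
    rewrite addr0 (bigD1 ord0)//= big1 => [|i /negPf->]; last by rewrite !mulr0.
    by rewrite !mulr1 addr0.
  by rewrite expr1n addr0 mulr1.
pose w i := (C ord0 (lift ord0 i) + C (lift ord0 i) ord0) / 2.
have splitC := fun S phi q => @qform_split S phi r C q (lt0r_neq0 s0).
have [|W HW] := IH (fun i j => C (lift ord0 i) (lift ord0 j) - w i * w j / s).
  move=> v.
  (* This choice of the first coordinate makes the completed square vanish, so the
     remaining form inherits the lower bound. *)
  pose v0 := - \sum_i w i / s * v i.
  pose v' i := if unlift ord0 i is Some j then v j else v0.
  have v'0 : v' ord0 = v0 by rewrite /v' unlift_none.
  have v'l i : v' (lift ord0 i) = v i by rewrite /v' liftK.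
  have := Cp v'; have /= := splitC _ idfun v'; rewrite -/s -/w v'0.
  under eq_bigr do rewrite v'l.
  rewrite addNr expr0n mulr0 add0r => -> H.
  have <- : qform (fun i j => C (lift ord0 i) (lift ord0 j) - w i * w j / s)
     (fun i => v' (lift ord0 i)) =
     qform (fun i j => C (lift ord0 i) (lift ord0 j) - w i * w j / s) v.
    by apply: eq_bigr => i _; apply: eq_bigr => j _; rewrite !v'l.
  apply: le_trans H; rewrite ler_pM2l// big_ord_recl.
  by under [in leRHS]eq_bigr do rewrite v'l; rewrite lerDr sqr_ge0.
pose q1 i := if unlift ord0 i is Some j then Num.sqrt s * (w j / s) else Num.sqrt s.
pose q2 k i := if unlift ord0 i is Some j then W k j else 0.
exists (fun k => if unlift ord0 k is Some k' then q2 k' else q1) => S phi q.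
rewrite splitC HW [RHS]big_ord_recl unlift_none -/s -/w; congr (_ + _).
  rewrite big_ord_recl {1}/q1 unlift_none.
  under [in RHS]eq_bigr do rewrite /q1 liftK rmorphM -mulrA.
  by rewrite -mulr_sumr -mulrDr exprMn -rmorphXn sqr_sqrtr// ltW.
apply: eq_bigr => k _; rewrite liftK; congr (_ ^+ 2).
rewrite big_ord_recl {1}/q2 unlift_none rmorph0 mul0r add0r.
by apply: eq_bigr => i _; rewrite /q2 liftK.
Qed.

End QuadraticForm.

(** * Points of the box that are far from S(g) *)

Section Compactness.
Context {R : realType} {n m : nat}.

Lemma meval_continuous (p : {mpoly R[n]}) :
  continuous (fun y : 'rV[R]_n => p.@[y 0] : R).
Proof.
have -> : (fun y : 'rV[R]_n => p.@[y 0]) =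
    fun y => \sum_(mon <- msupp p) p@_mon * \prod_i y 0 i ^+ mon i.
  by apply: funext => y; rewrite mevalE.
apply: continuous_big => [|mon _]; first exact: add_continuous.
move=> y; apply: continuousM; first exact: cst_continuous.
move: y; apply: continuous_big => [|i _]; first exact: mul_continuous.
suff powc k : continuous (fun v : 'rV[R]_n => v 0 i ^+ k) by exact: powc.
elim: k => [|k IH]; first by move=> y; exact: cst_continuous.
have -> : (fun v : 'rV[R]_n => v 0 i ^+ k.+1) = (fun v => v 0 i * v 0 i ^+ k).
  by apply: funext => v; rewrite exprS.
move=> y; apply: (@continuousM _ _ (fun v : 'rV[R]_n => v 0 i) (fun v => v 0 i ^+ k)).
  exact: coord_continuous.
exact: IH.
Qed.

Lemma box_compact (b : R) : compact (@box R n b).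
Proof.
have -> : @box R n b = [set v | forall i, `[- b, b]%classic (v ord0 i)].
  apply/seteqP; split=> v vb i; have := vb i; rewrite /= in_itv/= ler_norml//.
exact: (@rV_compact _ n (fun=> `[- b, b]%classic) (fun=> @segment_compact R (- b) b)).
Qed.

(** The points of the box at distance at least rho from S(g) form a compact set on
which the sum of the negative parts of the g_i is positive; its minimum there
is positive, and some g_i has to contribute a fixed share of it. *)
Lemma near_or_negative (g : 'I_m -> {mpoly R[n]}) (b rho : R) : 0 < rho ->
  exists2 eta, 0 < eta & forall y, box b y ->
    (exists2 y', semialg g y' & forall a, `|y 0 a - y' 0 a| <= rho) \/
    (exists i, (g i).@[y 0] <= - eta).
Proof.
move=> rho0.
pose far := [set y : 'rV[R]_n | forall y', semialg g y' -> rho <= `|y - y'| ].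
have far_near y : box b y -> ~ far y ->
    exists2 y', semialg g y' & forall a, `|y 0 a - y' 0 a| <= rho.
  move=> yb /existsNP[y' /not_implyP[gy' /negP]]; rewrite -ltNge => yy'.
  exists y' => // a; apply: le_trans (ltW yy').
  have -> : y 0 a - y' 0 a = (y - y') 0 a by rewrite !mxE.
  rewrite {2}/Num.norm/= mx_normrE.
  exact: (le_bigmax _ (fun ij : 'I_1 * 'I_n => `|(y - y') ij.1 ij.2|) (0, a)).
have far_closed : closed far.
  have -> : far = \bigcap_(y' in semialg g) [set y | rho <= `|y - y'| ].
    by apply/seteqP; split.
  apply: closed_bigI => y' _.
  have -> : [set y : 'rV[R]_n | rho <= `|y - y'| ] =
      (fun y : 'rV[R]_n => `|y - y'| : R) @^-1` [set u | rho <= u] by [].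
  apply: preimage_closed; last exact: closed_ge.
  move=> y _; apply: continuous_comp; last exact: norm_continuous.
  by apply: continuousB; [exact: cvg_id|exact: cst_continuous].
pose K := box b `&` far.
pose phi (y : 'rV[R]_n) : R := \sum_i (`|(g i).@[y 0]| - (g i).@[y 0]).
have phi0 i (y : 'rV[R]_n) : 0 <= `|(g i).@[y 0]| - (g i).@[y 0].
  by rewrite subr_ge0 ler_norm.
have [K0|K0] := pselect (K !=set0); last first.
  exists 1 => // y yb; left; apply: far_near => // yf; apply: K0; by exists y.
have cK : compact K by apply: compact_closedI => //; exact: box_compact.
have cphi : continuous phi.
  apply: continuous_big => [|i _]; first exact: add_continuous.
  pose gi (y : 'rV[R]_n) : R := (g i).@[y 0].
  have cgi : continuous gi by exact: meval_continuous.
  move=> y; apply: (@continuousB _ _ _ (fun y => `|gi y|) gi) => //.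
  exact: (@continuous_comp _ _ _ gi Num.norm y (cgi y) (@norm_continuous _ R^o (gi y))).
  exact: cgi.
have [c cK' cmin] := EVT_min_rV K0 cK (continuous_subspaceT cphi).
have [cb cf] : K c by move: cK'; rewrite inE.
have mu0 : 0 < phi c.
  rewrite lt_neqAle sumr_ge0// andbT; apply/eqP => /esym/eqP.
  rewrite psumr_eq0// => /allP c0.
  have /cf : semialg g c.
    move=> i; have := c0 i; rewrite mem_index_enum => /(_ isT)/eqP/eqP.
    by rewrite subr_eq0 => /eqP <-.
  by rewrite subrr normr0 leNgt rho0.
pose eta := phi c / (2 * (m.+1)%:R).
have eta0 : 0 < eta by rewrite divr_gt0// mulr_gt0.
exists eta => // y yb.
have [yf|yf] := pselect (far y); last by left; exact: far_near.
right; apply: contrapT => /forallNP H.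
have : phi y < phi c; last first.
  by rewrite ltNge cmin// inE.
apply: (@le_lt_trans _ _ (\sum_(i < m) 2 * eta)).
  apply: ler_sum => i _; have /negP := H i; rewrite -ltNge => /ltW gi.
  have [g0|g0] := ger0P (g i).@[y 0]; first by rewrite subrr mulr_ge0// ltW.
  by lra.
have <- : eta * (2 * (m.+1)%:R) = phi c by rewrite /eta divfK// mulf_neq0.
rewrite sumr_const card_ord -[ltLHS]mulr_natr -mulrA mulrCA.
by rewrite !ltr_pM2l// ltr_nat.
Qed.

End Compactness.

(** * Positivity on S(g) extended to the box *)

Lemma qformB {R : realType} r (C C' : 'I_r -> 'I_r -> R) v :
  qform C v - qform C' v = qform (fun i j => C i j - C' i j) v.
Proof.
rewrite /qform -sumrB; apply: eq_bigr => i _; rewrite -sumrB.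
by apply: eq_bigr => j _; rewrite mulrBl.
Qed.

Lemma qform_le {R : realType} r (C : 'I_r -> 'I_r -> R) E v :
  (forall i j, `|C i j| <= E) -> `|qform C v| <= (r * r)%:R * E * \sum_i v i ^+ 2.
Proof.
move=> CE; set N := \sum_i v i ^+ 2.
have vN i : v i ^+ 2 <= N.
  by rewrite /N (bigD1 i)//= lerDl sumr_ge0// => j _; rewrite sqr_ge0.
have vvN i j : `|v i * v j| <= N.
  have := vN i; have := vN j; have := sqr_ge0 (v i - v j).
  have := sqr_ge0 (v i + v j); rewrite ler_norml; nra.
apply: (@le_trans _ _ (\sum_(i < r) \sum_(j < r) E * N)).
  apply: le_trans (ler_norm_sum _ _ _) _; apply: ler_sum => i _.
  apply: le_trans (ler_norm_sum _ _ _) _; apply: ler_sum => j _.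
  by rewrite normrM ler_pM.
by rewrite !sumr_const card_ord -mulrnA -[leLHS]mulr_natl mulrA.
Qed.

(** The left-hand side counts j + 1 terms, each of which is at most the
corresponding term of the sum t (1 - t)^i over i <= j, equal to 1 - (1-t)^(j+1). *)
Lemma bernoulli_bump {R : realType} (t : R) j : 0 <= t <= 1 ->
  t * (1 - t) ^+ j * j.+1%:R <= 1 - (1 - t) ^+ j.+1.
Proof.
move=> /andP[t0 t1]; elim: j => [|j IH]; first by rewrite expr0 expr1 !mulr1; lra.
have p0 : 0 <= (1 - t) ^+ j.+1 by rewrite exprn_ge0// subr_ge0.
have p1 : (1 - t) ^+ j.+1 <= 1 by rewrite exprn_ile1// ?subr_ge0//; lra.
rewrite [(1 - t) ^+ j.+2]exprS -[j.+2]addn1 natrD.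
have -> : t * (1 - t) ^+ j.+1 * (j.+1%:R + 1) =
  (1 - t) * (t * (1 - t) ^+ j * j.+1%:R) + t * (1 - t) ^+ j.+1 by rewrite exprS; ring.
nra.
Qed.

(** Together with [penalty_neg]: multiplication by the square (1 - u / c)^(2k)
makes positive values of u negligible and never diminishes negative ones. *)
Lemma penalty_bump {R : realType} (u c : R) k : 0 < c -> `|u| <= c ->
  u * (1 - u / c) ^+ k.*2 <= c / k.*2.+1%:R.
Proof.
move=> c0 uc; have [u0|u0] := lerP 0 u; last first.
  apply: (@le_trans _ _ 0); last by rewrite divr_ge0// ltW.
  by rewrite mulr_le0_ge0 ?(ltW u0)// -muln2 exprM sqr_ge0.
rewrite ger0_norm// in uc.
have t01 : 0 <= u / c <= 1 by rewrite divr_ge0 ?(ltW c0)//= ler_pdivrMr// mul1r.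
have := bernoulli_bump k.*2 t01; set t := u / c => H.
have -> : u = c * t by rewrite /t mulrC divfK// lt0r_neq0.
rewrite -mulrA ler_pM2l// -[leRHS]mul1r ler_pdivlMr ?ltr0n//.
apply: le_trans H _.
by rewrite lerBlDr lerDl exprn_ge0// subr_ge0; case/andP: t01.
Qed.

Lemma penalty_neg {R : realType} (u c eta : R) k : 0 < c -> 0 < eta -> u <= - eta ->
  u * (1 - u / c) ^+ k.*2 <= - eta.
Proof.
move=> c0 e0 ue; apply: (le_trans _ ue).
have u0 : u <= 0 by rewrite (le_trans ue)// oppr_le0 ltW.
rewrite -[leRHS]mulr1 ler_wnM2l// exprn_ege1//.
by rewrite lerDl oppr_ge0 mulr_le0_ge0// invr_ge0 ltW.
Qed.

Section Penalty.
Context {R : realType} {n m : nat} (g : 'I_m -> {mpoly R[n]}).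
Context (b : R) (gb : semialg g `<=` box b).

(** Near S(g) the form H stays positive by continuity and the penalty is
negligible.  Elsewhere some g_l is at most - eta, and the factor lam is so
large that its penalty compensates for the lowest possible value of H.  The
squares s_l^2 depend on H only through its bounds. *)
Lemma penalty T (A : set T) r (H : 'I_r -> 'I_r -> T -> {mpoly R[n]}) (dl : R) :
  0 < dl -> (forall i j, ubd A (H i j)) ->
  (forall t y v, A t -> semialg g y ->
    dl * \sum_i v i ^+ 2 <= qform (fun i j => (H i j t).@[y 0]) v) ->
  exists s : 'I_m -> {mpoly R[n]}, forall t y v, A t -> box b y ->
    dl / 2 * \sum_i v i ^+ 2 <= qform (fun i j => (H i j t).@[y 0]) v -
      (\sum_l (g l).@[y 0] * (s l).@[y 0] ^+ 2) * \sum_i v i ^+ 2.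
Proof.
move=> dl0 HC Hpos.
have [L L1 HL'] := ubd_lipschitz_fin b (fun ij : 'I_r * 'I_r => HC ij.1 ij.2).
have L0 : 0 < L := lt_le_trans ltr01 L1.
have HL i j := HL' (i, j).
have [C C1 HC'] := ubd_box_fin b (fun ij : 'I_r * 'I_r => HC ij.1 ij.2).
have C0 : 0 <= C := le_trans ler01 C1.
have HCb i j := HC' (i, j).
have [c c1 Hc'] := ubd_box_fin b (fun l => ubdK (A := [set: unit]) (g l)).
have c0 : 0 < c := lt_le_trans ltr01 c1.
have Hc l y : box b y -> `|(g l).@[y 0]| <= c := Hc' l tt y I.
pose N : R := (r * r)%:R.
have N0 : 0 <= N by [].
(* Moving by at most rho in each coordinate changes the form by at most dl / 4. *)
pose rho := dl / 4 / ((N + 1) * (L * (n.+1)%:R)).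
have rho0 : 0 < rho by rewrite !divr_gt0// !mulr_gt0// ltr_wpDl.
have rhoE : (N + 1) * (L * (n.+1%:R * rho)) = dl / 4.
  have nn0 : 0 < n.+1%:R :> R by [].
  have NN0 : 0 < N + 1 by rewrite ltr_wpDl.
  rewrite /rho; move: (n.+1%:R : R) nn0 (N + 1) NN0 => nn nn0 NN NN0.
  by field; rewrite !lt0r_neq0.
have [eta eta0 Heta] := near_or_negative g b rho0.
(* N * C bounds the form from below by its coefficients. *)
pose lam := (N * C + dl) / eta.
have lam0 : 0 < lam by rewrite divr_gt0// ltr_wpDl// mulr_ge0.
have lamE : lam * eta = N * C + dl by rewrite divfK// lt0r_neq0.
(* For this order the positive penalties add up to at most dl / 4. *)
pose W := lam * (m%:R * c) / (dl / 4).
pose k := (Num.truncn W).+1.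
have Wk : W < k.*2.+1%:R.
  apply: (@lt_le_trans _ _ k%:R); first exact: truncnS_gt.
  by rewrite ler_nat -addnn -addnS leq_addr.
have kk0 : 0 < k.*2.+1%:R :> R by rewrite ltr0n.
pose kap := lam * (c / k.*2.+1%:R).
have kap0 : 0 <= kap by apply: mulr_ge0; [exact: ltW|rewrite divr_ge0 // ltW].
have mkap : m%:R * kap <= dl / 4.
  rewrite /kap !mulrA ler_pdivrMr// [leRHS]mulrC -ler_pdivrMr ?divr_gt0//.
  have -> : m%:R * (N * C + dl) / eta * c / (dl / 4) = W by rewrite /W /lam; ring.
  exact: ltW.
exists (fun l => (Num.sqrt lam)%:MP * (1 - c^-1 *: g l) ^+ k) => t y v At yb.
set V := \sum_i v i ^+ 2.
have V0 : 0 <= V by rewrite sumr_ge0// => i _; rewrite sqr_ge0.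
have sE l : (g l).@[y 0] * ((Num.sqrt lam)%:MP * (1 - c^-1 *: g l) ^+ k).@[y 0] ^+ 2 =
   lam * ((g l).@[y 0] * (1 - (g l).@[y 0] / c) ^+ k.*2).
  rewrite mevalM mevalC rmorphXn/= mevalB meval1 mevalZ exprMn sqr_sqrtr ?ltW//.
  by rewrite -exprM muln2 [_ / c]mulrC; ring.
pose F l := lam * ((g l).@[y 0] * (1 - (g l).@[y 0] / c) ^+ k.*2).
have {sE} -> : \sum_l (g l).@[y 0] * ((Num.sqrt lam)%:MP * (1 - c^-1 *: g l) ^+ k).@[y 0] ^+ 2
  = \sum_l F l.
  by apply: eq_bigr => l _; exact: sE.
have Fk l : F l <= kap by rewrite ler_pM2l// penalty_bump// Hc.
have sumk (P : pred 'I_m) : \sum_(l | P l) F l <= dl / 4.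
  apply: le_trans mkap; apply: (@le_trans _ _ (\sum_(l | P l) kap)); first exact: ler_sum.
  apply: (@le_trans _ _ (\sum_(l < m) kap)).
    by rewrite [leRHS](bigID P)/= lerDl sumr_ge0.
  by rewrite sumr_const card_ord -[leLHS]mulr_natl.
have [[y' gy' yy']|[l gl]] := Heta y yb.
- have dist : `|qform (fun i j => (H i j t).@[y 0]) v - qform (fun i j => (H i j t).@[y' 0]) v|
     <= dl / 4 * V.
    rewrite qformB -rhoE.
    apply: le_trans (qform_le _ (E := L * (n.+1%:R * rho)) _) _.
      move=> i j; apply: le_trans (HL i j t y y' At yb (gb gy')) _.
      rewrite ler_pM2l//; apply: (@le_trans _ _ (\sum_(a < n) rho)); first exact: ler_sum.
      by rewrite sumr_const card_ord -[leLHS]mulr_natl ler_pM2r// ler_nat.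
    rewrite ler_wpM2r// ler_wpM2r// ?lerDl//.
    by apply: mulr_ge0; [exact: ltW|apply: mulr_ge0 => //; exact: ltW].
  have := Hpos t y' v At gy'; have := ler_wpM2r V0 (sumk predT).
  move: dist; rewrite ler_norml -/V => /andP[].
  move: (qform _ _) (qform _ _) (\sum_(l | _) F l) => Q Q' S.
  lra.
- have := qform_le v (fun i j => HCb i j t y At yb); rewrite -/V -/N.
  rewrite ler_norml => /andP[D1 D2].
  have Fl : F l <= - (N * C + dl).
    by rewrite -lamE -mulrN ler_pM2l// penalty_neg.
  have S1 : \sum_l F l <= - (N * C + dl) + dl / 4.
    by rewrite (bigD1 l)//= lerD// sumk.
  have := ler_wpM2r V0 S1; rewrite mulrDl mulNr mulrDl.
  move: (qform _ _) D1 D2 (\sum_(l | _) F l) => Q D1 D2 S S2.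
  have : 0 <= dl * V by rewrite mulr_ge0// ltW.
  lra.
Qed.

End Penalty.

(** * Matrix polynomials that are positive definite on S(g) *)

Section UniformPutinar.
Context {R : realType} {n m : nat} (g : 'I_m -> {mpoly R[n]}).

Lemma archimedean_box_ball : archimedean_qmodule g ->
  exists2 b : R, 0 < b & qmodule g (box_ball b).
Proof.
move=> /(_ (\sum_a 'X_a ^+ 2)) [N N0 [_ HN]].
exists N%:R; first by rewrite ltr0n.
have -> : box_ball N%:R = (N%:R ^+ 2 - N%:R)%:MP * 1 + (N%:R - \sum_a 'X_a ^+ 2) :> {mpoly R[n]}.
  by rewrite /box_ball mulr1 rmorphB/= [in RHS]mpolyC_nat; ring.
apply: qmoduleD => //; apply: qmodule_sosM; last exact: qmodule1.
apply: sosC; rewrite subr_ge0 -natrX ler_nat.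
by rewrite expnS expn1 leq_pmulr.
Qed.

Lemma box_ball_box (b : R) : 0 < b -> qmodule g (box_ball b) -> semialg g `<=` box b.
Proof.
move=> b0 hM y gy a; have := qmodule_semialg hM gy.
rewrite /box_ball mevalB mevalC [X in _ - X]raddf_sum/= subr_ge0.
under eq_bigr do rewrite rmorphXn/= mevalXU.
move=> H; rewrite -ler_sqr ?nnegrE ?normr_ge0//; last exact: ltW.
rewrite real_normK ?num_real//; apply: le_trans H.
by rewrite (bigD1 a)//= lerDl sumr_ge0// => j _; rewrite sqr_ge0.
Qed.

Lemma qmodule_bernstein (b : R) K (al : {ffun 'I_n -> 'I_K.+1}) :
  0 < b -> qmodule g (box_ball b) -> qmodule g (bernstein b al).
Proof.
move=> b0 hM; apply: preordering1_qmodule (hM) _.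
have sc c : 0 <= c -> preordering1 (box_ball b) (c%:MP).
  by move=> c0; apply: preordering1_sos; exact: sosC.
apply: preordering1_prod => i; apply: preordering1M.
  by rewrite -mpolyC_nat; exact: sc.
have c0 : 0 <= (2 * b)^-1 by rewrite invr_ge0 mulr_ge0 ?ltW.
have [fp fm] := preordering1_face i b0.
by apply: preordering1M; apply: preordering1X; apply: preordering1M => //; exact: sc.
Qed.

Lemma msize_lincomb r (c : 'I_r -> R) (q : 'I_r -> {mpoly R[n]}) D :
  (forall i, (msize (q i) <= D)%N) -> (msize (\sum_i (c i)%:MP * q i)%R <= D)%N.
Proof.
move=> qD; apply: leq_trans (msize_sum _ _ _) _; apply/bigmax_leqP => i _.
by rewrite mul_mpolyC; apply: leq_trans (msizeZ_le _ _) _.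
Qed.

Lemma qmodule_family_bound (I : finType) (p : I -> {mpoly R[n]}) :
  (forall i, qmodule g (p i)) -> exists d, forall i, trunc_qmodule d g (p i).
Proof.
move=> /(_ _)/cid2 pM; exists (\max_i s2val (pM i))%N => i.
by apply: trunc_qmodule_le (s2valP' (pM i)); exact: (leq_bigmax i).
Qed.

(** Subtracting the penalty makes the matrix positive definite on the box, its
Bernstein coefficients c are then positive definite, and Cholesky turns each
of them into squares of linear combinations of the q i.  The number of basis
polynomials and the degrees depend on the bounds of the families only. *)
Lemma uniform_putinar T (A : set T) r (H : 'I_r -> 'I_r -> T -> {mpoly R[n]})
    (q : 'I_r -> T -> {mpoly R[n]}) (dl : R) :
  archimedean_qmodule g -> 0 < dl -> (forall i j, ubd A (H i j)) ->
  (forall i, ubd A (q i)) ->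
  (forall t y v, A t -> semialg g y ->
    dl * \sum_i v i ^+ 2 <= qform (fun i j => (H i j t).@[y 0]) v) ->
  exists d, forall t, A t ->
    trunc_qmodule d g (qform (fun i j => H i j t) (fun i => q i t)).
Proof.
move=> garch dl0 HC qC Hpos.
have [b b0 hM] := archimedean_box_ball garch.
have gb := box_ball_box b0 hM.
have [s Hs] := penalty gb dl0 HC Hpos.
pose pen := \sum_l g l * s l ^+ 2.
pose K i j t := H i j t - (i == j)%:R * pen.
have KC i j : ubd A (K i j) by apply: ubdB => //; exact: ubdK.
have penE v : qform (fun i j : 'I_r => ((i == j)%:R * pen)) v = pen * \sum_i v i ^+ 2.
  rewrite /qform mulr_sumr; apply: eq_bigr => i _.
  rewrite (bigD1 i)//= eqxx mul1r big1 ?addr0// => j /negPf ji.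
  by rewrite eq_sym ji !mul0r.
have Kpos t y v : A t -> box b y ->
    dl / 2 * \sum_i v i ^+ 2 <= qform (fun i j => (K i j t).@[y 0]) v.
  move=> At yb; apply: le_trans (Hs t y v At yb) _.
  rewrite le_eqVlt; apply/orP; left; apply/eqP.
  have -> : (\sum_l (g l).@[y 0] * (s l).@[y 0] ^+ 2) * \sum_i v i ^+ 2 =
      qform (fun i j : 'I_r => ((i == j)%:R * pen).@[y 0]) v.
    have <- : pen.@[y 0] = \sum_l (g l).@[y 0] * (s l).@[y 0] ^+ 2.
      by rewrite raddf_sum/=; apply: eq_bigr => l _; rewrite mevalM rmorphXn.
    rewrite /qform mulr_sumr; apply: eq_bigr => i _.
    rewrite (bigD1 i)//= eqxx mul1r big1 ?addr0// => j /negPf ji.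
    by rewrite eq_sym ji !mul0r meval0 mul0r.
  rewrite qformB; apply: eq_bigr => i _; apply: eq_bigr => j _.
  by rewrite mevalB.
(* With this accuracy for the entries, the form is off by at most dl / 4. *)
pose e := dl / 4 / ((r * r)%:R + 1).
have rr0 : 0 < (r * r)%:R + 1 :> R by rewrite ltr_wpDl.
have e0 : 0 < e by rewrite !divr_gt0.
have /choice[K0 HK0] : forall ij : 'I_r * 'I_r, exists K0, forall k, (K0 <= k)%N ->
   exists c, forall t, A t -> K ij.1 ij.2 t = \sum_al c t al *: bernstein b al /\
    forall al : {ffun 'I_n -> 'I_k.+1}, `|c t al - (K ij.1 ij.2 t).@[grid b al 0]| <= e.
  by move=> [i j]; exact: (ubd_bernstein b0 (KC i j) e0).
pose k := (\max_ij K0 ij).+1.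
have /choice[c Hc] : forall ij : 'I_r * 'I_r,
   exists c, forall t, A t -> K ij.1 ij.2 t = \sum_al c t al *: bernstein b al /\
    forall al : {ffun 'I_n -> 'I_k.+1}, `|c t al - (K ij.1 ij.2 t).@[grid b al 0]| <= e.
  move=> ij; apply: HK0; apply: leqW; exact: (leq_bigmax ij).
have cpos t al v : A t -> dl / 4 * \sum_i v i ^+ 2 <= qform (fun i j => c (i, j) t al) v.
  move=> At; have := Kpos t (grid b al) v At (grid_box b0 _ _).
  move=> /(_ isT).
  have : `|qform (fun i j => c (i, j) t al) v -
      qform (fun i j => (K i j t).@[grid b al 0]) v| <= dl / 4 * \sum_i v i ^+ 2.
    rewrite qformB; apply: le_trans (qform_le _ (E := e) _) _.
      by move=> i j; exact: (Hc (i, j) t At).2.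
    rewrite ler_wpM2r ?sumr_ge0// => [i _|]; first exact: sqr_ge0.
    rewrite /e mulrCA; apply: ler_piMr; first by rewrite divr_ge0// ltW.
    by rewrite ler_pdivrMr// mul1r lerDl.
  rewrite ler_norml => /andP[].
  move: (qform _ _) (qform _ _) => Q Q'; lra.
have [d1 Hd1] := qmodule_family_bound (fun al : {ffun 'I_n -> 'I_k.+1} =>
  qmodule_bernstein al b0 hM).
have [d2 Hd2] : exists d, forall l, trunc_qmodule d g (s l ^+ 2 * g l).
  apply: qmodule_family_bound => l; apply: qmodule_sqrM.
  by eexists => //; rewrite -gen_lift -[gen _ _]mul1r -[1](expr1n _ 2); exact: trunc_qmodule_gen.
have [D HD] : exists D, forall i t, A t -> (msize (q i t) <= D)%N.
  have /choice[D HD] : forall i, exists D, forall t, A t -> (msize (q i t) <= D)%N.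
    by move=> i; have [D [C HDC]] := qC i; exists D => t /HDC[].
  exists (\max_i D i)%N => i t /(HD i) /leq_trans; apply.
  exact: leq_bigmax.
exists (maxn d1 d2 + D.*2.+2)%N => t At.
have HKE i j : H i j t = K i j t + (i == j)%:R * pen by rewrite subrK.
have -> : qform (fun i j => H i j t) (fun i => q i t) =
  \sum_al bernstein b al * qform (fun i j => (c (i, j) t al)%:MP) (fun i => q i t) +
  \sum_i \sum_l q i t ^+ 2 * (s l ^+ 2 * g l).
  transitivity (qform (fun i j => K i j t) (fun i => q i t) + pen * \sum_i q i t ^+ 2).
    rewrite -penE /qform -big_split; apply: eq_bigr => i _.
    rewrite -big_split; apply: eq_bigr => j _.
    by rewrite HKE mulrDl.
  congr (_ + _); last first.
    rewrite mulr_sumr; apply: eq_bigr => i _; rewrite mulr_suml.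
    by apply: eq_bigr => l _; ring.
  transitivity (\sum_i \sum_j \sum_al
     bernstein b al * ((c (i, j) t al)%:MP * (q i t * q j t))).
    apply: eq_bigr => i _; apply: eq_bigr => j _.
    rewrite (Hc (i, j) t At).1 mulr_suml; apply: eq_bigr => al _.
    by rewrite -mul_mpolyC; ring.
  under eq_bigr do rewrite exchange_big.
  rewrite exchange_big; apply: eq_bigr => al _ /=.
  by rewrite /qform mulr_sumr; apply: eq_bigr => i _; rewrite mulr_sumr.
apply: trunc_qmoduleD; last first.
  apply: trunc_qmodule_sum => i; apply: trunc_qmodule_sum => l.
  apply: trunc_qmodule_sqrM; first exact: HD.
  exact: trunc_qmodule_le (leq_maxr _ _) (Hd2 l).
apply: trunc_qmodule_sum => al.
have dl40 : 0 < dl / 4 by rewrite divr_gt0.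
have [W HW] := cholesky dl40 (fun v => cpos t al v At).
rewrite (HW _ (@mpolyC n R)) mulr_sumr.
apply: trunc_qmodule_sum => i; rewrite mulrC; apply: trunc_qmodule_sqrM.
  by apply: msize_lincomb => j; exact: HD.
exact: trunc_qmodule_le (leq_maxl _ _) (Hd1 al).
Qed.

End UniformPutinar.

(** * A single zero *)

Section OneZero.
Context {R : realType} {n m : nat} (g : 'I_m -> {mpoly R[n]}).

Lemma meval_limit_ge (p : {mpoly R[n]}) b (x v : 'rV[R]_n) K tau0 : 0 < tau0 ->
  box b x ->
  (forall tau, 0 < tau <= tau0 -> box b (x + tau *: v) /\ K <= p.@[(x + tau *: v) 0]) ->
  K <= p.@[x 0].
Proof.
move=> tau00 xb Hp; rewrite leNgt; apply/negP => pK.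
have [L L1 HL] := ubd_lipschitz b (ubdK (A := [set: unit]) p).
have L0 : 0 < L := lt_le_trans ltr01 L1.
pose V := \sum_a `|v 0 a|.
have V0 : 0 <= V by rewrite sumr_ge0.
pose W := L * V + 1.
have W0 : 0 < W by rewrite ltr_wpDl// mulr_ge0// ltW.
pose tau := Num.min tau0 ((K - p.@[x 0]) / W).
have tau_gt0 : 0 < tau by rewrite lt_min tau00 divr_gt0// subr_gt0.
have [|yb pK'] := Hp tau; first by rewrite tau_gt0 ge_min lexx.
have := HL tt _ _ I yb xb.
have -> : \sum_a `|(x + tau *: v) 0 a - x 0 a| = tau * V.
  rewrite mulr_sumr; apply: eq_bigr => a _.
  by rewrite !mxE addrC addKr normrM gtr0_norm.
have tW : tau * W <= K - p.@[x 0].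
  by rewrite -ler_pdivlMr// ge_min lexx orbT.
rewrite ler_norml => /andP[_].
have : tau * W = L * (tau * V) + tau by rewrite /W; ring.
move: (p.@[_]) pK' => u; lra.
Qed.

Lemma eucl_ball_line (x v : 'rV[R]_n) eps : 0 < eps -> exists2 tau0, 0 < tau0 &
  forall tau, 0 < tau <= tau0 -> eucl_ball x eps (x + tau *: v).
Proof.
move=> eps0; pose V := eucl_norm v.
have V0 : 0 <= V by exact: sqrtr_ge0.
exists (eps / (V + 1)) => [|tau /andP[tau0 tauV]]; first by rewrite divr_gt0// ltr_wpDl.
have -> : eucl_ball x eps (x + tau *: v) = (tau * V < eps) :> Prop.
  rewrite /eucl_ball/= /eucl_norm; congr (is_true (_ < _)).
  under eq_bigr do rewrite !mxE opprD addNKr sqrrN exprMn.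
  by rewrite -mulr_sumr sqrtrM ?sqr_ge0// sqrtr_sqr gtr0_norm.
apply: le_lt_trans (ler_wpM2r V0 tauV) _.
by rewrite mulrAC ltr_pdivrMr ?ltr_wpDl// ltr_pM2l// ltrDl.
Qed.

Lemma eucl_ball_center (x : 'rV[R]_n) eps : 0 < eps -> eucl_ball x eps x.
Proof.
move=> eps0; rewrite /eucl_ball/= /eucl_norm big1 ?sqrtr0// => a _.
by rewrite !mxE subrr expr0n.
Qed.

Lemma sqdistE (x y : 'rV[R]_n) : (sqdist_poly x).@[y 0] = \sum_a (y 0 a - x 0 a) ^+ 2.
Proof.
rewrite raddf_sum/=; apply: eq_bigr => a _.
by rewrite rmorphXn/= mevalB mevalXU mevalC.
Qed.

Lemma sqdist_ge0 (x y : 'rV[R]_n) : 0 <= (sqdist_poly x).@[y 0].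
Proof. by rewrite sqdistE sumr_ge0// => a _; rewrite sqr_ge0. Qed.

Lemma sqdist_line (x v : 'rV[R]_n) tau :
  (sqdist_poly x).@[(x + tau *: v) 0] = tau ^+ 2 * \sum_a v 0 a ^+ 2.
Proof.
rewrite sqdistE mulr_sumr; apply: eq_bigr => a _.
by rewrite !mxE [_ + _ - _]addrC addKr exprMn.
Qed.

Definition displacement (x : 'rV[R]_n) (a : 'I_n) : {mpoly R[n]} := 'X_a - (x 0 a)%:MP.

Lemma displacement_line (x v : 'rV[R]_n) tau a :
  (displacement x a).@[(x + tau *: v) 0] = tau * v 0 a.
Proof. by rewrite mevalB mevalXU mevalC !mxE [_ + _ - _]addrC addKr. Qed.

Lemma meval_qform r (C : 'I_r -> 'I_r -> {mpoly R[n]}) q (y : 'rV[R]_n) :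
  (qform C q).@[y 0] = qform (fun i j => (C i j).@[y 0]) (fun i => (q i).@[y 0]).
Proof.
rewrite raddf_sum/=; apply: eq_bigr => i _; rewrite raddf_sum/=.
by apply: eq_bigr => j _; rewrite !mevalM.
Qed.

Lemma sbd_coord T (A : set T) b (x : T -> 'rV[R]_n) a :
  (forall t, A t -> box b (x t)) -> sbd A (fun t => x t 0 a).
Proof. by move=> xb; exists b => t /xb. Qed.

Lemma ubd_displacement T (A : set T) b (x : T -> 'rV[R]_n) a :
  (forall t, A t -> box b (x t)) -> ubd A (fun t => displacement (x t) a).
Proof. by move=> xb; apply: ubdB; [exact: ubdK|apply/ubdC/(sbd_coord _ xb)]. Qed.

Lemma ubd_sqdist T (A : set T) b (x : T -> 'rV[R]_n) :
  (forall t, A t -> box b (x t)) -> ubd A (fun t => sqdist_poly (x t)).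
Proof. by move=> xb; apply: ubd_sum => a; apply: ubdX; exact: (ubd_displacement _ xb). Qed.

(** The first division of h at x has quotients r a that vanish at x, because h is
nonnegative on a ball around its zero x, so that all directional derivatives
at x are nonnegative.  A second division gives G.  Comparing h with
c |y - x|^2 along a segment starting at x and letting its length tend to 0
bounds the form G(x) from below. *)
Lemma hessian_expansion T (A : set T) b (x : T -> 'rV[R]_n) (h : T -> {mpoly R[n]}) c eps :
  0 < c -> 0 < eps -> semialg g `<=` box b -> ubd A h ->
  (forall t, A t -> eucl_ball (x t) eps `<=` semialg g) ->
  (forall t, A t -> (h t).@[x t 0] = 0) ->
  (forall t y, A t -> semialg g y -> c * (sqdist_poly (x t)).@[y 0] <= (h t).@[y 0]) ->
  exists2 G : 'I_n -> 'I_n -> T -> {mpoly R[n]}, forall i j, ubd A (G i j) &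
    forall t, A t ->
      h t = qform (fun i j => G i j t) (displacement (x t)) /\
      forall v, c * \sum_i v i ^+ 2 <= qform (fun i j => (G i j t).@[x t 0]) v.
Proof.
move=> c0 eps0 gb hC xg hx hpos.
have xb t : A t -> box b (x t).
  by move=> At; apply/gb/(xg t At); exact: eucl_ball_center.
have line t v : A t -> exists2 tau0, 0 < tau0 & forall tau, 0 < tau <= tau0 ->
    semialg g (x t + tau *: v).
  move=> At; have [tau0 tau00 H] := eucl_ball_line (x t) v eps0.
  by exists tau0 => // tau /H; exact: xg.
have [_ [r rC rE]] := ubd_divisible xb hC.
have hE t : A t -> h t = \sum_a r a t * displacement (x t) a.
  by move=> At; rewrite {1}rE// hx// mpolyC0 add0r.
have rx t a : A t -> (r a t).@[x t 0] = 0.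
  move=> At.
  (* The direction opposite to the gradient forces the gradient to vanish. *)
  pose v : 'rV[R]_n := \row_i - (r i t).@[x t 0].
  have [tau0 tau00 Hline] := line t v At.
  have : 0 <= (\sum_i (v 0 i) *: r i t).@[x t 0].
    apply: (meval_limit_ge (b := b) (v := v) tau00); first exact: xb.
    move=> tau tau_le; have gy := Hline tau tau_le.
    have /andP[tau_gt0 _] := tau_le; split; first exact: gb.
    have := hpos t _ At gy.
    have -> : (h t).@[(x t + tau *: v) 0] =
        tau * (\sum_i (v 0 i) *: r i t).@[(x t + tau *: v) 0].
      rewrite (hE t At) [LHS]raddf_sum [in RHS]raddf_sum mulr_sumr.
      apply: eq_bigr => i _.
      by rewrite /= mevalM displacement_line mevalZ; ring.
    move=> H; rewrite -(pmulr_rge0 _ tau_gt0); apply: le_trans H.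
    by rewrite mulr_ge0 ?sqdist_ge0// ltW.
  rewrite raddf_sum/=.
  under eq_bigr do rewrite mevalZ mxE mulNr -expr2.
  rewrite sumrN oppr_ge0 => le0.
  have ge0 : 0 <= \sum_i (r i t).@[x t 0] ^+ 2.
    by rewrite sumr_ge0// => i _; rewrite sqr_ge0.
  have /eqP := le_anti (introT andP (conj le0 ge0)).
  rewrite psumr_eq0 => [/allP /(_ a)|i _]; last exact: sqr_ge0.
  by rewrite mem_index_enum sqrf_eq0 => /(_ isT) /eqP.
have /choice[G HG] : forall a, exists Ga : 'I_n -> T -> {mpoly R[n]},
    (forall i, ubd A (Ga i)) /\
    forall t, A t -> r a t = \sum_i Ga i t * displacement (x t) i.
  move=> a; have [_ [s sC sE]] := ubd_divisible xb (rC a).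
  by exists s; split=> // t At; rewrite {1}sE// rx// mpolyC0 add0r.
have hG t : A t -> h t = qform (fun i j => G i j t) (displacement (x t)).
  move=> At; rewrite hE//; apply: eq_bigr => i _.
  rewrite (HG i).2// mulr_suml; apply: eq_bigr => j _.
  by rewrite mulrAC mulrA.
exists G => [i j|t At]; first exact: (HG i).1.
split=> [|v]; first exact: hG.
pose w : 'rV[R]_n := \row_i v i.
have [tau0 tau00 Hline] := line t w At.
pose P := qform (fun i j => G i j t) (fun i => (v i)%:MP).
have PE (y : 'rV[R]_n) : P.@[y 0] = qform (fun i j => (G i j t).@[y 0]) v.
  rewrite meval_qform; apply: eq_bigr => i _; apply: eq_bigr => j _.
  by rewrite !mevalC.
rewrite -PE; apply: (meval_limit_ge (b := b) (v := w) tau00); first exact: xb.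
move=> tau tau_le; have gy := Hline tau tau_le.
have /andP[tau_gt0 _] := tau_le; split; first exact: gb.
have := hpos t _ At gy; rewrite (hG t At) sqdist_line meval_qform PE.
have tau2 : 0 < tau ^+ 2 by rewrite exprn_gt0.
have -> : qform (fun i j => (G i j t).@[(x t + tau *: w) 0])
   (fun i => (displacement (x t) i).@[(x t + tau *: w) 0]) =
   tau ^+ 2 * qform (fun i j => (G i j t).@[(x t + tau *: w) 0]) v.
  rewrite /qform mulr_sumr; apply: eq_bigr => i _; rewrite mulr_sumr.
  by apply: eq_bigr => j _; rewrite !displacement_line !mxE; ring.
rewrite mulrCA ler_pM2l//.
by under eq_bigr do rewrite mxE.
Qed.

(** The form G is positive definite near x only.  It is replaced by
phi G + chi h I, where phi = (1 - u / U)^J is 1 at x and small away from x,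
and u chi = 1 - phi.  This form takes the same value h at X - x, and on S(g)
the summand chi h is at least c (1 - phi). *)
Lemma uniform_one_zero T (A : set T) (x : T -> 'rV[R]_n) (h : T -> {mpoly R[n]}) c eps :
  archimedean_qmodule g -> 0 < c -> 0 < eps -> ubd A h ->
  (forall t, A t -> eucl_ball (x t) eps `<=` semialg g) ->
  (forall t, A t -> (h t).@[x t 0] = 0) ->
  (forall t y, A t -> semialg g y -> c * (sqdist_poly (x t)).@[y 0] <= (h t).@[y 0]) ->
  exists d, forall t, A t -> trunc_qmodule d g (h t).
Proof.
move=> garch c0 eps0 hC xg hx hpos.
have [b b0 hM] := archimedean_box_ball garch.
have gb := box_ball_box b0 hM.
have xb t : A t -> box b (x t).
  by move=> At; apply/gb/(xg t At); exact: eucl_ball_center.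
have [G GC GE] := hessian_expansion c0 eps0 gb hC xg hx hpos.
have [L L1 HL'] := ubd_lipschitz_fin b (fun ij : 'I_n * 'I_n => GC ij.1 ij.2).
have L0 : 0 < L := lt_le_trans ltr01 L1.
have [C C1 HC'] := ubd_box_fin b (fun ij : 'I_n * 'I_n => GC ij.1 ij.2).
have C0 : 0 < C := lt_le_trans ltr01 C1.
have [U U1 HU] := ubd_box b (ubd_sqdist xb).
have U0 : 0 < U := lt_le_trans ltr01 U1.
have U0' : 0 <= U := ltW U0.
pose N : R := (n * n)%:R.
have N0 : 0 <= N by [].
(* Within distance rho of x the form G is at least c / 2. *)
pose rho := c / 2 / ((N + 1) * (L * (n.+1)%:R)).
have NN0 : 0 < N + 1 by rewrite ltr_wpDl.
have rho0 : 0 < rho by rewrite !divr_gt0// !mulr_gt0.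
have rhoE : (N + 1) * (L * (n.+1%:R * rho)) = c / 2.
  have nn0 : 0 < n.+1%:R :> R by [].
  rewrite /rho; move: (n.+1%:R : R) nn0 (N + 1) NN0 => nn nn0 NN NN0'.
  by field; rewrite !lt0r_neq0.
(* Where phi <= kap, the negative part of phi G is compensated by c (1 - phi). *)
pose kap := c / 2 / (N * C + c).
have NCc : 0 < N * C + c by rewrite ltr_wpDl// mulr_ge0// ltW.
have kap0 : 0 < kap by rewrite !divr_gt0.
have kapE : kap * (N * C + c) = c / 2 by rewrite divfK// lt0r_neq0.
(* By [bernoulli_bump], phi <= kap as soon as u > rho^2. *)
pose J := (Num.truncn (U / rho ^+ 2 / kap)).+1.
have rho2 : 0 < rho ^+ 2 by rewrite exprn_gt0.
have JE : U / rho ^+ 2 / kap < J%:R by exact: truncnS_gt.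
pose w t := 1 - U^-1 *: sqdist_poly (x t).
pose phi t := w t ^+ J.
pose chi t := U^-1 *: \sum_(l < J) w t ^+ l.
have wC : ubd A w.
  by apply: ubdB; [exact: ubdK|apply: ubdZ; [exact: sbd_const|exact: (ubd_sqdist xb)]].
have chiE t : chi t * sqdist_poly (x t) = 1 - phi t.
  have w1 : w t - 1 = - (U^-1 *: sqdist_poly (x t)) by rewrite /w addrC addKr.
  by rewrite -[RHS]opprB subrX1 w1 mulNr opprK /chi -!scalerAl mulrC.
pose H i j t := phi t * G i j t + (i == j)%:R * (chi t * h t).
have HC i j : ubd A (H i j).
  apply: ubdD; first by apply: ubdM => //; exact: ubdX.
  apply: ubdM; first exact: ubdK.
  apply: ubdM => //; apply: ubdZ; first exact: sbd_const.
  by apply: ubd_sum => l; exact: ubdX.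
have diagE (S : comNzRingType) (z : S) (v : 'I_n -> S) (F : 'I_n -> 'I_n -> S) p :
   qform (fun i j => p * F i j + (i == j)%:R * z) v = p * qform F v + z * \sum_i v i ^+ 2.
  rewrite /qform !mulr_sumr -big_split; apply: eq_bigr => i _ /=.
  under eq_bigr do rewrite mulrDl.
  rewrite big_split/= mulr_sumr; congr (_ + _).
    by apply: eq_bigr => j _; rewrite -mulrA.
  rewrite (bigD1 i)//= eqxx mul1r big1 ?addr0// => j /negPf ji.
  by rewrite eq_sym ji !mul0r.
have HE t : A t -> h t = qform (fun i j => H i j t) (displacement (x t)).
  move=> At; rewrite diagE -(GE t At).1.
  by rewrite -/(sqdist_poly (x t)) mulrAC chiE; ring.
have [|||d Hd] := @uniform_putinar R n m g T A n H (fun i t => displacement (x t) i) (c / 2)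
    garch _ HC.
- by rewrite divr_gt0.
- by move=> i; exact: (ubd_displacement _ xb).
- move=> t y v At gy; have yb := gb _ gy.
  set V := \sum_i v i ^+ 2.
  have V0 : 0 <= V by rewrite sumr_ge0// => i _; rewrite sqr_ge0.
  pose u := (sqdist_poly (x t)).@[y 0].
  have u0 : 0 <= u by exact: sqdist_ge0.
  have uU : u <= U by apply: le_trans (ler_norm _) (HU t y At yb).
  have wE : (w t).@[y 0] = 1 - u / U by rewrite mevalB meval1 mevalZ mulrC.
  have uU01 : 0 <= u / U <= 1 by rewrite divr_ge0//= ler_pdivrMr// mul1r.
  have /andP[uU0 uU1] := uU01.
  pose f := (phi t).@[y 0].
  have fE : f = (1 - u / U) ^+ J by rewrite /f rmorphXn/= wE.
  have f0 : 0 <= f by rewrite fE exprn_ge0// subr_ge0.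
  have f1 : f <= 1 by rewrite fE exprn_ile1// ?subr_ge0//; lra.
  pose k := (chi t).@[y 0].
  have k0 : 0 <= k.
    rewrite /k mevalZ mulr_ge0 ?invr_ge0// raddf_sum sumr_ge0//= => l _.
    by rewrite rmorphXn/= wE exprn_ge0// subr_ge0.
  have ku : k * u = 1 - f.
    by rewrite /k /u -mevalM chiE mevalB meval1.
  pose Q := qform (fun i j => (G i j t).@[y 0]) v.
  have -> : qform (fun i j => (H i j t).@[y 0]) v = f * Q + k * (h t).@[y 0] * V.
    rewrite -diagE; apply: eq_bigr => i _; apply: eq_bigr => j _.
    by rewrite mevalD !mevalM rmorph_nat.
  have hk : c * (1 - f) * V <= k * (h t).@[y 0] * V.
    rewrite ler_wpM2r// -ku mulrCA ler_wpM2l//.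
    exact: hpos.
  apply: le_trans (lerD (lexx _) hk).
  have [near|far] := lerP u (rho ^+ 2).
  + have Qnear : c / 2 * V <= Q.
      have := (GE t At).2 v.
      have : `|Q - qform (fun i j => (G i j t).@[x t 0]) v| <= c / 2 * V.
        rewrite /Q qformB -rhoE.
        apply: le_trans (qform_le _ (E := L * (n.+1%:R * rho)) _) _.
          move=> i j; apply: le_trans (HL' (i, j) t y _ At yb (xb t At)) _.
          rewrite ler_pM2l//; apply: (@le_trans _ _ (\sum_(a < n) rho)).
            apply: ler_sum => a _; rewrite -ler_sqr ?nnegrE//; last exact: ltW.
            rewrite real_normK ?num_real//; apply: le_trans near.
            rewrite /u sqdistE (bigD1 a)//= lerDl sumr_ge0// => a' _.
            by rewrite sqr_ge0.
          by rewrite sumr_const card_ord -[leLHS]mulr_natl ler_pM2r// ler_nat.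
        rewrite ler_wpM2r// ler_wpM2r// ?lerDl//.
        by apply: mulr_ge0; [exact: ltW|apply: mulr_ge0 => //; exact: ltW].
      rewrite ler_norml -/V => /andP[].
      move: (qform _ _) => Q'; lra.
    have := ler_wpM2l f0 Qnear; have : 0 <= c * (1 - f) * V.
      by rewrite !mulr_ge0 ?subr_ge0// ltW.
    move: (f * Q) => fQ; lra.
  + have fk : f <= kap.
      have := bernoulli_bump J uU01; rewrite -fE => H1.
      have H2 : u / U * f * J.+1%:R <= 1.
        by apply: le_trans H1 _; rewrite lerBlDr lerDl exprn_ge0// subr_ge0.
      rewrite leNgt; apply/negP => kf.
      have : 1 < u / U * f * J.+1%:R; last by rewrite ltNge H2.
      have JJ : J%:R < J.+1%:R :> R by rewrite ltr_nat.
      have JE' : U / rho ^+ 2 / kap < J.+1%:R := lt_trans JE JJ.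
      have e1 : (rho ^+ 2 / U) * kap * (U / rho ^+ 2 / kap) = 1.
        by field; rewrite !lt0r_neq0.
      rewrite -[ltLHS]e1; apply: ltr_pM => //.
      * by apply: mulr_ge0; [rewrite divr_ge0// ltW|exact: ltW].
      * by rewrite !divr_ge0// ltW.
      apply: ltr_pM => //; [by rewrite divr_ge0// ltW|exact: ltW|].
      by rewrite ltr_pM2r// invr_gt0.
    have := qform_le v (fun i j => HC' (i, j) t y At yb); rewrite -/V -/N -/Q.
    rewrite ler_norml => /andP[D1 _].
    have := ler_wpM2l f0 D1.
    have : f * (N * C + c) * V <= c / 2 * V.
      rewrite ler_wpM2r// -kapE ler_wpM2r// ltW//.
    have -> : f * - (N * C * V) = - (f * (N * C) * V) by ring.
    have -> : f * (N * C + c) * V = f * (N * C) * V + f * c * V by ring.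
    have -> : c * (1 - f) * V = c * V - f * c * V by ring.
    move: (f * Q) (f * (N * C) * V) (f * c * V) => X Y Z; lra.
by exists d => t At; rewrite HE//; exact: Hd.
Qed.

End OneZero.

(** * From membership to the value of the relaxation *)

(** Evaluation at a minimizer is feasible for the relaxation, and membership of
f - a in the truncated module bounds every feasible value from below. *)
Lemma lasserre_exact {R : realType} {n m : nat} (g : 'I_m -> {mpoly R[n]}) d f a x :
  polys_le d f -> semialg g x -> f.@[x 0] = a ->
  trunc_qmodule d g (f - a%:MP) -> lasserre d f g = a%:E.
Proof.
move=> fd gx fx fM; apply/le_anti/andP; split.
  apply: ereal_inf_lbound; exists (fun p => p.@[x 0]); last by rewrite fx.
  split=> [c p q _ _|p pM|]; last exact: meval1.
    by rewrite mevalD mevalZ.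
  by apply: (qmodule_semialg _ gx); exists d.
apply: le_ereal_inf_tmp => _ [L [Llin Lpos L1] <-]; rewrite lee_fin.
have p0 : polys_le d (0 : {mpoly R[n]}) by rewrite /polys_le/= msize0.
have p1 : polys_le d (1 : {mpoly R[n]}) by rewrite /polys_le/= msize1.
have pa : polys_le d (a%:MP : {mpoly R[n]}).
  by rewrite /polys_le/= msizeC; case: (_ != _).
have L0 : L 0 = 0.
  by have := Llin 1 0 0 p0 p0; rewrite scaler0 addr0 mul1r => /eqP; rewrite -subr_eq subrr => /eqP.
have La : L a%:MP = a.
  by have := Llin a 1 0 p1 p0; rewrite L0 L1 mulr1 !addr0 -mul_mpolyC mulr1.
have pfa : polys_le d (f - a%:MP).
  rewrite /polys_le/= (leq_trans (msizeD_le _ _))// geq_max mmeasureN.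
  by apply/andP; split.
have := Llin 1 _ _ pfa pa; rewrite scale1r subrK mul1r La => ->.
by rewrite lerDr; exact: Lpos.
Qed.

(** * Several zeros *)

(** The quotient (1 - z^k y^j) / (1 - z), as soon as 1 - y = cz (1 - z). *)
Definition bezout_weight (S : comNzRingType) (cz y z : S) k j : S :=
  \sum_(l < k) z ^+ l + z ^+ k * cz * \sum_(l < j) y ^+ l.

Lemma bezout_weightE (S : comNzRingType) (cz y z : S) k j :
  1 - y = cz * (1 - z) ->
  (1 - z) * bezout_weight cz y z k j + z ^+ k * y ^+ j = 1.
Proof.
move=> yz; have geom (w : S) l : (1 - w) * \sum_(i < l) w ^+ i = 1 - w ^+ l.
  by rewrite -[RHS]opprB subrX1 -mulNr opprB.
rewrite /bezout_weight mulrDr geom.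
have -> : (1 - z) * (z ^+ k * cz * \sum_(l < j) y ^+ l) =
    z ^+ k * ((cz * (1 - z)) * \sum_(l < j) y ^+ l) by ring.
by rewrite -yz geom; ring.
Qed.

Lemma rmorph_bezout_weight (S S' : comNzRingType) (phi : {rmorphism S -> S'})
    (cz y z : S) k j :
  phi (bezout_weight cz y z k j) = bezout_weight (phi cz) (phi y) (phi z) k j.
Proof.
rewrite /bezout_weight rmorphD !rmorphM rmorphXn !rmorph_sum.
by congr (_ + _ * _); apply: eq_bigr => l _; rewrite rmorphXn.
Qed.

(** By [bezout_weightE] it suffices that z^(2k) y^(2j) <= 1 when z < 1.  This is
clear for z >= 0, where y <= 1 too.  For z < 0 one has y <= Z / (1 + Z) < 1,
so a large j compensates for the bound Z^(2k) of the first factor. *)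
Lemma bezout_weight_ge0 {R : realType} (Z : R) k : 1 <= Z -> exists j, forall z,
  - Z <= z <= 1 ->
  0 <= bezout_weight (1 + Z)^-1 ((z + Z) / (1 + Z)) z k.*2 j.*2.
Proof.
move=> Z1; have Z0 : 0 < Z := lt_le_trans ltr01 Z1.
have ZZ0 : 0 < 1 + Z by rewrite addr_gt0.
pose B := Z ^+ k.*2 * (1 + Z).
exists (Num.truncn B).+1; set j := (Num.truncn B).+1.
have Bj : B < j%:R by exact: truncnS_gt.
move=> z /andP[zZ z1]; set y := (z + Z) / (1 + Z).
have y0 : 0 <= y by apply: divr_ge0; [lra|exact: ltW].
have y1 : y <= 1 by rewrite ler_pdivrMr// mul1r; lra.
have zk0 : 0 <= z ^+ k.*2 by rewrite -muln2 exprM sqr_ge0.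
have yj0 : 0 <= y ^+ j.*2 by rewrite exprn_ge0.
have zy1 : z ^+ k.*2 * y ^+ j.*2 <= 1.
  have [z0|z0] := lerP 0 z.
    have zk1 : z ^+ k.*2 <= 1 by rewrite exprn_ile1.
    by rewrite mulr_ile1// exprn_ile1.
  have zkZ : z ^+ k.*2 <= Z ^+ k.*2.
    have e2 (w : R) : w ^+ k.*2 = (w ^+ 2) ^+ k by rewrite -muln2 mulnC exprM.
    by rewrite !e2 lerXn2r ?nnegrE ?sqr_ge0//; nra.
  have cz01 : 0 <= (1 + Z)^-1 <= 1.
    by rewrite invr_ge0 (ltW ZZ0)/= invf_le1// lerDl ltW.
  have yle : y <= 1 - (1 + Z)^-1.
    by rewrite ler_pdivrMr// mulrBl mulVf ?lt0r_neq0//; lra.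
  have := bernoulli_bump j.*2 cz01; set q := (1 - (1 + Z)^-1) ^+ j.*2.
  have yq : y ^+ j.*2 <= q.
    by rewrite lerXn2r ?nnegrE//; lra.
  move=> H1.
  have H2 : q * j.*2.+1%:R <= 1 + Z.
    rewrite -[leRHS]mul1r -ler_pdivrMr// mulrC mulrA; apply: le_trans H1 _.
    rewrite lerBlDr lerDl exprn_ge0//; lra.
  have q0 : 0 <= q by apply: le_trans yq.
  have jj : j%:R <= j.*2.+1%:R :> R by rewrite ler_nat -addnn -addnS leq_addr.
  have Zk0 : 0 < Z ^+ k.*2 by rewrite exprn_gt0.
  have H3 : Z ^+ k.*2 * q * (1 + Z) <= 1 + Z.
    apply: le_trans H2; rewrite mulrAC -/B mulrC ler_wpM2l//.
    by apply: le_trans (ltW Bj) jj.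
  have H4 : Z ^+ k.*2 * q <= 1 by rewrite -(ler_pM2r ZZ0) mul1r.
  by apply: le_trans H4; rewrite ler_pM.
have yz : 1 - y = (1 + Z)^-1 * (1 - z).
  by rewrite /y; field; rewrite lt0r_neq0.
have := bezout_weightE k.*2 j.*2 yz.
have [z1'|z1'] := ltrP z 1.
  move=> E; rewrite -(pmulr_rge0 _ (_ : 0 < 1 - z)) ?subr_gt0//.
  by rewrite -(lerD2r (z ^+ k.*2 * y ^+ j.*2)) E add0r.
move=> _; have -> : z = 1 by apply/le_anti/andP.
rewrite addr_ge0//; first by rewrite sumr_ge0// => l _; rewrite expr1n.
rewrite expr1n mul1r mulr_ge0 ?invr_ge0 ?(ltW ZZ0)// sumr_ge0// => l _.
by rewrite exprn_ge0.
Qed.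

(** The Lipschitz estimate at the zero x t, with every coordinate of y - x t
bounded by the Euclidean distance. *)
Lemma ubd_vanishing_sqr {R : realType} {n : nat} T (A : set T) b
    (P : T -> {mpoly R[n]}) (x : T -> 'rV[R]_n) :
  (forall t, A t -> box b (x t)) -> ubd A P ->
  (forall t, A t -> (P t).@[x t 0] = 0) ->
  exists2 C, 1 <= C & forall t y, A t -> box b y ->
    (P t).@[y 0] ^+ 2 <= C * (sqdist_poly (x t)).@[y 0].
Proof.
move=> xb PC Px; have [L L1 HL] := ubd_lipschitz b PC.
have L0 : 0 <= L := le_trans ler01 L1.
have Ln1 : 1 <= L * n.+1%:R by rewrite -[leLHS]mul1r ler_pM// ler1n.
exists ((L * n.+1%:R) ^+ 2) => [|t y At yb]; first exact: exprn_ege1.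
have := HL t y (x t) At yb (xb t At); rewrite Px// subr0 => H.
set u := (sqdist_poly (x t)).@[y 0].
have u0 : 0 <= u by exact: sqdist_ge0.
have da a : `|y 0 a - x t 0 a| <= Num.sqrt u.
  rewrite -sqrtr_sqr ler_wsqrtr// /u sqdistE (bigD1 a)//= lerDl sumr_ge0// => a' _.
  exact: sqr_ge0.
have {}H : `|(P t).@[y 0]| <= L * n.+1%:R * Num.sqrt u.
  apply: le_trans H _; rewrite -mulrA ler_wpM2l//.
  apply: (@le_trans _ _ (\sum_(a < n) Num.sqrt u)); first exact: ler_sum.
  by rewrite sumr_const card_ord -[leLHS]mulr_natl ler_wpM2r ?sqrtr_ge0// ler_nat.
rewrite -(sqr_sqrtr u0) -exprMn -real_normK ?num_real// lerXn2r ?nnegrE//.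
by rewrite mulr_ge0 ?sqrtr_ge0// mulr_ge0.
Qed.

Section ManyZeros.
Context {R : realType} {n m : nat} (g : 'I_m -> {mpoly R[n]}).
Context {T : Type} (A : set T) (k : nat) (x : 'I_k -> T -> 'rV[R]_n) (eps b : R).
Context (eps0 : 0 < eps).
Context (xb : forall i t, A t -> box b (x i t)).
Context (x_sep : forall t i l, A t -> i != l -> eps <= eucl_norm (x i t - x l t)).

Let u i t := sqdist_poly (x i t).

Let sep i l t := \sum_a (x i t 0 a - x l t 0 a) ^+ 2.

Let sep_ge i l t : A t -> i != l -> eps ^+ 2 <= sep i l t.
Proof.
move=> At il; have s0 : 0 <= sep i l t.
  by rewrite sumr_ge0// => a _; exact: sqr_ge0.
rewrite -(sqr_sqrtr s0) lerXn2r ?nnegrE ?sqrtr_ge0// ?(ltW eps0)//.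
apply: le_trans (x_sep At il) _; rewrite /eucl_norm.
by under eq_bigr do rewrite !mxE.
Qed.

(* The affine function equal to 1 at x_i and to 0 at x_l, constant in the directions
   orthogonal to x_i - x_l (for distinct zeros). *)
Let line i l t : {mpoly R[n]} :=
  \sum_a ((x i t 0 a - x l t 0 a) * (sep i l t)^-1)%:MP * displacement (x l t) a.

Let line_ubd i l : i != l -> ubd A (line i l).
Proof.
move=> il; apply: ubd_sum => a; apply: ubdM; last exact: (ubd_displacement _ (xb l)).
apply: ubdC; apply: sbdM.
  exists (b + b) => t At; rewrite (le_trans (ler_normB _ _))//.
  by rewrite lerD// ?xb.
exists (eps ^+ 2)^-1 => t At; have e2 : 0 < eps ^+ 2 by rewrite exprn_gt0.
have s0 := lt_le_trans e2 (sep_ge At il).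
by rewrite gtr0_norm ?invr_gt0// lef_pV2// sep_ge.
Qed.

Let line0 i l t : (line i l t).@[x l t 0] = 0.
Proof.
rewrite raddf_sum big1// => a _.
by rewrite /= mevalM mevalB mevalXU !mevalC subrr mulr0.
Qed.

Let line1 i l t : A t -> i != l -> (line i l t).@[x i t 0] = 1.
Proof.
move=> At il; have e2 : 0 < eps ^+ 2 by rewrite exprn_gt0.
have s0 := lt_le_trans e2 (sep_ge At il).
rewrite raddf_sum -[RHS](divff (lt0r_neq0 s0)) {2}/sep mulr_suml.
apply: eq_bigr => a _ /=; rewrite mevalM mevalB mevalXU !mevalC.
by rewrite mulrAC -expr2.
Qed.

(** The square of each factor of p_i is at most a constant times the u_l of the
zero x_l of that factor. *)
Lemma lagrange_family : exists p : 'I_k -> T -> {mpoly R[n]},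
  [/\ forall i, ubd A (p i),
      forall i j t, A t -> (p i t).@[x j t 0] = (i == j)%:R &
      exists2 C, 1 <= C & forall i t y, A t -> box b y ->
        (p i t).@[y 0] ^+ 2 * (u i t).@[y 0] <= C * (\prod_l u l t).@[y 0]].
Proof.
pose p i t := \prod_(l | l != i) (if i == l then 0 else line i l t).
have lineC i l : ubd A (fun t => if i == l then 0 else line i l t).
  by have [_|il] := eqVneq i l; [exact: ubdK|exact: line_ubd].
exists p; split=> [i|i j t At|]; first exact: ubd_prod.
- rewrite rmorph_prod/=; have [<-|ij] := eqVneq i j.
    rewrite big1// => l li; rewrite eq_sym (negPf li) line1// eq_sym//.
  rewrite (bigD1 j)/=; last by rewrite eq_sym.
  by rewrite (negPf ij) line0 mul0r.
have [C C1 HC] : exists2 C, 1 <= C & forall (il : 'I_k * 'I_k) t y, A t -> box b y ->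
    (if il.1 == il.2 then 0 else line il.1 il.2 t).@[y 0] ^+ 2 <= C * (u il.2 t).@[y 0].
  apply: fin_uniform_bound => [[i l] C C' CC' H t y At yb|[i l]].
    by apply: le_trans (H t y At yb) _; rewrite ler_wpM2r// sqdist_ge0.
  apply: ubd_vanishing_sqr => //=; first exact: xb.
  by move=> t At; case: eqP => _; rewrite ?meval0.
have C0 : 0 <= C := le_trans ler01 C1.
exists (C ^+ k) => [|i t y At yb]; first exact: exprn_ege1.
rewrite !rmorph_prod/= [X in _ <= _ * X](bigD1 i)//= mulrCA mulrC.
rewrite ler_wpM2l ?sqdist_ge0// -prodrXl.
apply: (@le_trans _ _ (\prod_(l | l != i) (C * (u l t).@[y 0]))).
  by apply: ler_prod => l _; rewrite sqr_ge0; exact: (HC (i, l)).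
rewrite big_split/= prodr_const ler_wpM2r//.
  by rewrite prodr_ge0// => l _; exact: sqdist_ge0.
by rewrite ler_weXn2l// (leq_trans (max_card _))// card_ord.
Qed.

End ManyZeros.

(** The decomposition FE reduces the claim to the families h i, with one zero
each, and to h0, which is bounded below by c on S(g). *)
Lemma uniform_many_zeros {R : realType} {n m : nat} (g : 'I_m -> {mpoly R[n]})
    T (A : set T) k (x : 'I_k -> T -> 'rV[R]_n) (F : T -> {mpoly R[n]}) (eps : R) :
  archimedean_qmodule g -> (0 < k)%N -> 0 < eps -> ubd A F ->
  (forall i t, A t -> eucl_ball (x i t) eps `<=` semialg g) ->
  (forall t i l, A t -> i != l -> eps <= eucl_norm (x i t - x l t)) ->
  (forall i t, A t -> (F t).@[x i t 0] = 0) ->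
  (forall t y, A t -> semialg g y ->
     eps * (\prod_i sqdist_poly (x i t)).@[y 0] <= (F t).@[y 0]) ->
  exists d, forall t, A t -> trunc_qmodule d g (F t).
Proof.
move=> garch k0 eps0 FC xg x_sep Fx Fpos.
have [b b0 hM] := archimedean_box_ball garch.
have gb := box_ball_box b0 hM.
have xb i t : A t -> box b (x i t).
  by move=> At; apply/gb/(xg i t At); exact: eucl_ball_center.
pose u i t := sqdist_poly (x i t).
have uC i : ubd A (u i) by exact: (ubd_sqdist (xb i)).
pose U t := \prod_i u i t.
have U0 t (y : 'rV[R]_n) : 0 <= (U t).@[y 0].
  by rewrite rmorph_prod prodr_ge0// => i _; exact: sqdist_ge0.
have [p [pC px [C1 C11 HC1]]] := lagrange_family eps0 xb x_sep.
(* The polynomial z vanishes at all zeros, so that z^2 <= C2 u_i for every i; this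
   is why the power 2k of z is dominated by the product of the u_i. *)
pose z t := 1 - \sum_i p i t ^+ 2.
have zC : ubd A z.
  by apply: ubdB; [exact: ubdK|apply: ubd_sum => i; exact: ubdX].
have zx j t : A t -> (z t).@[x j t 0] = 0.
  move=> At; rewrite mevalB meval1 [X in _ - X]raddf_sum/= (bigD1 j)//= big1.
    by rewrite rmorphXn/= px// eqxx expr1n addr0 subrr.
  by move=> i /negPf ij; rewrite rmorphXn/= px// ij expr0n.
have [C2 C21 HC2] : exists2 C, 1 <= C & forall i t y, A t -> box b y ->
    (z t).@[y 0] ^+ 2 <= C * (u i t).@[y 0].
  apply: fin_uniform_bound => [i C C' CC' H t y At yb|i].
    by apply: le_trans (H t y At yb) _; rewrite ler_wpM2r// sqdist_ge0.
  by apply: ubd_vanishing_sqr => // [t|t]; [exact: xb|exact: zx].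
have zU t y : A t -> box b y -> (z t).@[y 0] ^+ k.*2 <= C2 ^+ k * (U t).@[y 0].
  move=> At yb; rewrite rmorph_prod/= -muln2 mulnC exprM.
  have <- : \prod_(i < k) C2 = C2 ^+ k by rewrite prodr_const card_ord.
  have <- : \prod_(i < k) (z t).@[y 0] ^+ 2 = ((z t).@[y 0] ^+ 2) ^+ k.
    by rewrite prodr_const card_ord.
  rewrite -big_split/=; apply: ler_prod => i _.
  by rewrite sqr_ge0 HC2.
pose M := k%:R * C1 + C2 ^+ k.
have M0 : 0 < M.
  rewrite ltr_wpDl ?mulr_ge0// ?(le_trans ler01 C11)//.
  by rewrite exprn_gt0// (lt_le_trans ltr01).
(* For this c, the part subtracted in F' is at most eps times the product of the
   u_i on the box. *)
pose c := eps / M.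
have c0 : 0 < c by rewrite divr_gt0.
have cM : c * M = eps by rewrite divfK// lt0r_neq0.
pose F' t := F t - c *: (\sum_i p i t ^+ 2 * u i t + z t ^+ k.*2).
have F'C : ubd A F'.
  apply: ubdB => //; apply: ubdZ; first exact: sbd_const.
  apply: ubdD; last exact: ubdX.
  by apply: ubd_sum => i; apply: ubdM => //; exact: ubdX.
have F'pos t y : A t -> semialg g y -> 0 <= (F' t).@[y 0].
  move=> At gy; have yb := gb _ gy.
  rewrite mevalB mevalZ subr_ge0; apply: le_trans (Fpos t y At gy).
  rewrite -cM -mulrA ler_pM2l// mevalD rmorphXn/= /M mulrDl lerD ?zU//.
  have -> : k%:R * C1 * (U t).@[y 0] = \sum_(i < k) C1 * (U t).@[y 0].
    by rewrite sumr_const card_ord -mulrA mulr_natl.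
  rewrite raddf_sum.
  by apply: ler_sum => i _; rewrite /= mevalM rmorphXn; exact: HC1.
have F'x j t : A t -> (F' t).@[x j t 0] = 0.
  move=> At; rewrite mevalB mevalZ Fx// sub0r mevalD rmorphXn/= zx//.
  rewrite expr0n/= double_eq0 (gtn_eqF k0) addr0 raddf_sum big1 ?mulr0 ?oppr0// => i _.
  rewrite /= mevalM rmorphXn/= px//; have [->|] := eqVneq i j.
    by rewrite sqdistE big1 ?mulr0// => a _; rewrite subrr expr0n.
  by rewrite expr0n mul0r.
have [Z Z1 HZ] := ubd_box b zC.
have ZZ0 : 0 < 1 + Z by rewrite ltr_pwDl// (le_trans ler01 Z1).
have [j Hj] := bezout_weight_ge0 k Z1.
pose y' t := (1 + Z)^-1 *: (z t + Z%:MP).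
have y'C : ubd A y'.
  by apply: ubdZ; [exact: sbd_const|apply: ubdD => //; exact: ubdK].
pose e1 t := bezout_weight ((1 + Z)^-1)%:MP (y' t) (z t) k.*2 j.*2.
have e1C : ubd A e1.
  apply: ubdD; first by apply: ubd_sum => l; exact: ubdX.
  apply: ubdM; last by apply: ubd_sum => l; exact: ubdX.
  by apply: ubdM; [exact: ubdX|exact: ubdK].
have e1pos t y : A t -> box b y -> 0 <= (e1 t).@[y 0].
  move=> At yb; rewrite rmorph_bezout_weight/= mevalC mevalZ mevalD mevalC mulrC.
  apply: Hj; have := HZ t y At yb; rewrite ler_norml => /andP[-> _]/=.
  rewrite mevalB meval1 lerBlDr lerDl [X in _ <= X]raddf_sum sumr_ge0// => i _.
  by rewrite /= rmorphXn sqr_ge0.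
have e1E t : (1 - z t) * e1 t + z t ^+ k.*2 * y' t ^+ j.*2 = 1.
  apply: bezout_weightE; rewrite /y' -mul_mpolyC; set w := ((1 + Z)^-1)%:MP.
  have wK : w * (1 + Z%:MP) = 1.
    by rewrite /w -mpolyC1 -mpolyCD -mpolyCM mulVf// lt0r_neq0.
  by rewrite -[X in X - _]wK; ring.
pose h i t := c *: u i t + F' t * e1 t.
pose h0 t := c%:MP + F' t * y' t ^+ j.*2.
have FE t : F t = \sum_i p i t ^+ 2 * h i t + (z t ^+ k) ^+ 2 * h0 t.
  have zE : \sum_i p i t ^+ 2 = 1 - z t by rewrite /z opprB addrC subrK.
  have -> : \sum_i p i t ^+ 2 * h i t =
      c *: (\sum_i p i t ^+ 2 * u i t) + (1 - z t) * (F' t * e1 t).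
    rewrite -zE mulr_suml scaler_sumr -big_split; apply: eq_bigr => i _ /=.
    by rewrite mulrDr -scalerAr.
  rewrite -exprM muln2.
  have -> : c *: (\sum_i p i t ^+ 2 * u i t) + (1 - z t) * (F' t * e1 t) +
      z t ^+ k.*2 * h0 t = c *: (\sum_i p i t ^+ 2 * u i t + z t ^+ k.*2) +
      F' t * ((1 - z t) * e1 t + z t ^+ k.*2 * y' t ^+ j.*2).
    by rewrite /h0 scalerDr -!mul_mpolyC; ring.
  by rewrite e1E mulr1 /F' addrC subrK.
have [d0 Hd0] : exists d, forall t, A t -> trunc_qmodule d g ((z t ^+ k) ^+ 2 * h0 t).
  have [|||d Hd] := @uniform_putinar R n m g T A 1 (fun _ _ => h0) (fun _ t => z t ^+ k) c
    garch c0.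
  - move=> _ _; apply: ubdD; first exact: ubdK.
    by apply: ubdM => //; exact: ubdX.
  - by move=> _; exact: ubdX.
  - move=> t y v At gy; rewrite /qform !big_ord1 -expr2 ler_wpM2r ?sqr_ge0//.
    rewrite mevalD mevalC lerDl mevalM mulr_ge0 ?F'pos// rmorphXn/=.
    by rewrite -muln2 exprM sqr_ge0.
  by exists d => t /Hd; rewrite /qform !big_ord1 -expr2 mulrC.
have /choice[d1 Hd1] : forall i, exists d, forall t, A t -> trunc_qmodule d g (h i t).
  move=> i; apply: (@uniform_one_zero _ _ _ g _ A (x i) (h i) c eps) => //.
  - by apply: ubdD; [apply: ubdZ => //; exact: sbd_const|exact: ubdM].
  - by move=> t; exact: xg.
  - move=> t At; rewrite mevalD mevalZ mevalM F'x// mul0r addr0 sqdistE.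
    by rewrite big1 ?mulr0// => a _; rewrite subrr expr0n.
  - move=> t y At gy; rewrite mevalD mevalZ mevalM lerDl mulr_ge0 ?F'pos//.
    by apply: e1pos => //; exact: gb.
have /choice[D HD] : forall i, exists D, forall t, A t -> (msize (p i t) <= D)%N.
  by move=> i; have [D [C HDC]] := pC i; exists D => t /HDC[].
exists (maxn d0 (\max_i (d1 i + (D i).*2.+2)))%N => t At.
rewrite FE; apply: trunc_qmoduleD; last first.
  by apply: trunc_qmodule_le (Hd0 t At); exact: leq_maxl.
apply: trunc_qmodule_sum => i.
apply: trunc_qmodule_le (trunc_qmodule_sqrM (HD i t At) (Hd1 i t At)).
by rewrite leq_max (leq_bigmax i) orbT.
Qed.

Theorem theorem37 (R : realType) (n m : nat) (g : 'I_m -> {mpoly R[n]})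
    (garch : archimedean_qmodule g) (gne : semialg g !=set0)
    (k N : nat) (k_gt0 : (0 < k)%N) (N_gt0 : (0 < N)%N)
    (eps : R) (eps_gt0 : 0 < eps) :
  exists d : nat,
    forall f : {mpoly R[n]},
      polys_le N f ->
      (forall mon : 'X_{1..n}, - N%:R <= f@_mon <= N%:R) ->
    forall a : R,
      is_min [set f.@[y 0] | y in semialg g] a ->
    forall x : 'I_k -> 'rV[R]_n,
      [set y | semialg g y /\ f.@[y 0] = a] = range x ->
      trivIset setT (fun i => eucl_ball (x i) eps) ->
      (forall i, eucl_ball (x i) eps `<=` semialg g) ->
      (forall y, semialg g y ->
         (a%:MP + eps *: \prod_i sqdist_poly (x i)).@[y 0] <= f.@[y 0]) ->
    trunc_qmodule d g (f - a%:MP) /\ lasserre d f g = a%:E.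
Proof.
pose T := ({mpoly R[n]} * R * ('I_k -> 'rV[R]_n))%type.
pose A : set T := [set t : T | [/\ polys_le N t.1.1 /\
    (forall mon : 'X_{1..n}, - N%:R <= t.1.1@_mon <= N%:R),
    (forall i, t.1.1.@[t.2 i 0] = t.1.2),
    trivIset setT (fun i => eucl_ball (t.2 i) eps),
    (forall i, eucl_ball (t.2 i) eps `<=` semialg g) &
    (forall y, semialg g y -> eps * (\prod_i sqdist_poly (t.2 i)).@[y 0] <=
       (t.1.1 - (t.1.2)%:MP).@[y 0])]].
have [b b0 hM] := archimedean_box_ball garch.
have fC : ubd A (fun t : T => t.1.1).
  by exists N.+1, N%:R => t [[fN fc] _ _ _ _]; split=> // mon; rewrite ler_norml.
have FC : ubd A (fun t : T => t.1.1 - (t.1.2)%:MP).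
  apply: ubdB => //; apply: ubdC.
  pose i0 : 'I_k := Ordinal k_gt0.
  have [|C HC] := @ubd_meval _ _ _ A b _ (fun t : T => t.2 i0) _ fC.
    move=> t [_ _ _ xg _]; apply/(box_ball_box b0 hM)/(xg i0).
    exact: eucl_ball_center.
  by exists C => t At; have := HC t At; case: (At) => _ ->.
have [||||d Hd] := @uniform_many_zeros R n m g T A k (fun i (t : T) => t.2 i) _ eps garch k_gt0
  eps_gt0 FC.
- by move=> i t [_ _ _ xg _]; exact: xg.
- move=> t i l [_ _ xtriv _ _] il; rewrite leNgt; apply/negP => near.
  move/eqP: il; apply; apply: (xtriv i l) => //.
  by exists (t.2 l); split=> //; exact: eucl_ball_center.
- by move=> i t [_ fx _ _ _]; rewrite mevalB mevalC fx subrr.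
- by move=> t y [_ _ _ _]; exact.
exists (maxn d N) => f fN fc a _ x xE xtriv xg fpos.
have xS i : semialg g (x i) /\ f.@[x i 0] = a.
  have : range x (x i) by exists i.
  by rewrite -xE.
have fM : trunc_qmodule (maxn d N) g (f - a%:MP).
  apply: trunc_qmodule_le (leq_maxl _ _) _; apply: (Hd (f, a, x)); split=> //=.
    by move=> i; exact: (xS i).2.
  move=> y gy; rewrite mevalB mevalC lerBrDl.
  by have := fpos y gy; rewrite mevalD mevalC mevalZ.
split=> //; have [gx fx] := xS (Ordinal k_gt0).
apply: (lasserre_exact _ gx fx fM).
move: fN; rewrite /polys_le/= => /leq_trans; apply.
by rewrite ltnS leq_maxr.
Qed.
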